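(* Let $n\ge 1$ and let $\gamma$ denote the standard Gaussian density on $\mathbb{R}^n$. For every convex function $\Phi\colon\mathbb{R}\to\mathbb{R}$ and every $f\in C^1_{\mathrm{poly}}(\mathbb{R}^n)$, it holds $$ \int_{\mathbb{R}^n}\Phi\left(f(x)-\int_{\mathbb{R}^n} f(y)\,\gamma(y)\,dy\right)\gamma(x)\,dx \;\le\; \iint_{\mathbb{R}^n\times\mathbb{R}^n}\Phi\left(\frac{\pi}{2}\,\nabla f(x)\cdot y\right)\gamma(x)\gamma(y)\,dx\,dy $$ $$ =\;\frac{1}{\sqrt{2\pi}}\int_{\mathbb{R}^n}\int_{\mathbb{R}}\Phi\left(\frac{\pi}{2}\,|\nabla f(x)|\,z\right)e^{-z^2/2}\,\gamma(x)\,dz\,dx \;=\;\int_{\mathbb{R}^n}\widetilde\Phi\left(|\nabla f(x)|\right)\gamma(x)\,dx , $$ where $\widetilde\Phi$ is the convex function defined by $$ \widetilde\Phi(a)=\frac{1}{\sqrt{2\pi}}\int_{\mathbb{R}}\Phi\left(\frac{\pi}{2}\,a z\right)e^{-z^2/2}\,dz . $$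
   Context: $\gamma(x)=(2\pi)^{-n/2}\exp(-|x|^2/2)$, $x\in\mathbb{R}^n$, where $|\cdot|$ is the Euclidean norm and $\cdot$ the Euclidean inner product. For $k=0,1,\dots$, $C^k_{\mathrm{poly}}(\mathbb{R}^n)$ is the vector space of functions $f\colon\mathbb{R}^n\to\mathbb{R}$ that are continuously differentiable up to order $k$ and that are bounded in absolute value, together with all their partial derivatives up to order $k$, by a polynomial. Integrals of $\Phi$ composed with the displayed functions are understood as values in $(-\infty,+\infty]$ (a convex function is bounded below by an affine function, so the negative parts are integrable); likewise $\widetilde\Phi$ may take the value $+\infty$. *)

(* Defs.v *)
From HB Require Import structures.
From mathcomp Require Import all_boot all_order all_algebra.
From mathcomp Require Import all_classical all_reals all_analysis.
From mathcomp Require mpoly.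

Set Implicit Arguments.
Unset Strict Implicit.
Unset Printing Implicit Defensive.

Import Order.TTheory GRing.Theory Num.Theory.
Import numFieldNormedType.Exports.

Local Open Scope classical_set_scope.
Local Open Scope ring_scope.

(* R^n is 'rV[R]_n for R : realType. MathComp-Analysis has neither a
   sigma-algebra nor a Lebesgue measure on 'rV[R]_n; both are built here. *)

Definition measure_rV_display : measure_display.
Proof. exact: default_measure_display. Qed.

Section measurable_rV.
Variables (R : realType) (n : nat).

Let coors (i : 'I_n) (x : 'rV[R]_n) : measurableTypeR R := x ord0 i.

Let rV_set0 : g_sigma_preimage coors set0.
Proof. exact: sigma_algebra0. Qed.

Let rV_setC A : g_sigma_preimage coors A -> g_sigma_preimage coors (~` A).
Proof. exact: sigma_algebraC. Qed.

Let rV_bigcup (F : (set 'rV[R]_n)^nat) :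
  (forall i, g_sigma_preimage coors (F i)) ->
  g_sigma_preimage coors (\bigcup_i (F i)).
Proof. exact: sigma_algebra_bigcup. Qed.

(* the product of the n Borel sigma-algebras, as the library does for
   n.-tuple T *)
HB.instance Definition _ := @isMeasurable.Build measure_rV_display
  'rV[R]_n (g_sigma_preimage coors) rV_set0 rV_setC rV_bigcup.

End measurable_rV.

Lemma measurable_coord_rV (R : realType) n (i : 'I_n) :
  measurable_fun [set: 'rV[R]_n] (fun x => x ord0 i : measurableTypeR R).
Proof.
move=> _ Y mY; rewrite setTI; apply: sub_sigma_algebra => /=.
rewrite -bigcup_seq/=; exists i => /=; first by rewrite mem_index_enum.
by exists Y => //; rewrite setTI.
Qed.

Lemma measurable_fun_rV d (T : measurableType d) (R : realType) n
    (f : T -> 'rV[R]_n) :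
  (forall i, measurable_fun [set: T] (fun t => f t ord0 i : measurableTypeR R)) ->
  measurable_fun [set: T] f.
Proof.
move=> mf _ A mA; rewrite setTI.
suff: g_sigma_preimage (fun (i : 'I_n) (x : 'rV[R]_n) =>
          x ord0 i : measurableTypeR R)
        `<=` [set B | measurable (f @^-1` B)] by exact.
apply: smallest_sub; first split.
- by rewrite /= preimage_set0; exact: measurable0.
- by move=> B /= mB; rewrite setTD preimage_setC; exact: measurableC.
- by move=> F /= mF; rewrite preimage_bigcup; exact: bigcupT_measurable.
rewrite -bigcup_seq => B [i _ [C mC <-]] /=.
by have := mf i measurableT _ mC; rewrite !setTI.
Qed.

Section lebesgue_rV_step.
Variables (R : realType) (n : nat).
Variable mu : {sigma_finite_measure set 'rV[R]_n -> \bar R}.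

Definition cons_rV (p : measurableTypeR R * 'rV[R]_n) : 'rV[R]_n.+1 :=
  row_mx (p.1 : R)%:M p.2.

Lemma cons_rV0 p : cons_rV p ord0 ord0 = p.1.
Proof.
have -> : (ord0 : 'I_n.+1) = lshift n (ord0 : 'I_1) by exact: val_inj.
by apply: etrans (row_mxEl _ _ _ _) _; rewrite mxE.
Qed.

Lemma cons_rVS p (i : 'I_n) : cons_rV p ord0 (lift ord0 i) = p.2 ord0 i.
Proof.
have -> : lift ord0 i = rshift 1 i by exact: val_inj.
exact: row_mxEr.
Qed.

Lemma measurable_cons_rV : measurable_fun setT cons_rV.
Proof.
apply: measurable_fun_rV => i; case: (unliftP ord0 i) => [j ->|->].
- rewrite (_ : (fun _ => _) = (fun x : 'rV[R]_n => x ord0 j : measurableTypeR R)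
     \o snd); last by apply/funext => p; rewrite cons_rVS.
  by apply: measurableT_comp => //; exact: measurable_coord_rV.
- rewrite (_ : (fun _ => _) = fst); last by apply/funext => p; rewrite cons_rV0.
  exact: measurable_fst.
Qed.

Definition lebesgue_rVS : set 'rV[R]_n.+1 -> \bar R :=
  pushforward (lebesgue_measure \x mu)%E cons_rV.

Let lebesgue_rVS0 : lebesgue_rVS set0 = 0%E.
Proof. by rewrite /lebesgue_rVS /pushforward preimage_set0 measure0. Qed.

Let lebesgue_rVS_ge0 A : (0 <= lebesgue_rVS A)%E.
Proof. by rewrite /lebesgue_rVS /pushforward; exact: measure_ge0. Qed.

Let lebesgue_rVS_sigma_additive : semi_sigma_additive lebesgue_rVS.
Proof.
move=> F mF tF mUF; rewrite /lebesgue_rVS /pushforward preimage_bigcup.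
apply: measure_semi_sigma_additive.
- by move=> k; rewrite -[X in measurable X]setTI; exact: measurable_cons_rV.
- apply/trivIsetP => /= i j _ _ ij; rewrite -preimage_setI.
  by move/trivIsetP : tF => /(_ _ _ _ _ ij) ->//; rewrite preimage_set0.
- by rewrite -preimage_bigcup -[X in measurable X]setTI;
    exact: measurable_cons_rV.
Qed.

HB.instance Definition _ := isMeasure.Build _ _ _ lebesgue_rVS
  lebesgue_rVS0 lebesgue_rVS_ge0 lebesgue_rVS_sigma_additive.

Let uncons_rV (x : 'rV[R]_n.+1) : measurableTypeR R * 'rV[R]_n :=
  (x ord0 ord0, \row_i x ord0 (lift ord0 i)).

Let cons_rVK : cancel cons_rV uncons_rV.
Proof.
move=> p; rewrite /uncons_rV cons_rV0 [RHS]surjective_pairing; congr pair.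
by apply/rowP => i; rewrite mxE cons_rVS.
Qed.

Let measurable_uncons_rV : measurable_fun setT uncons_rV.
Proof.
apply/measurable_fun_pairP; split; first exact: measurable_coord_rV.
apply: measurable_fun_rV => i.
under eq_fun do rewrite /= mxE; exact: measurable_coord_rV.
Qed.

Let lebesgue_rVS_sigma_finite : sigma_finite setT lebesgue_rVS.
Proof.
have [F TF Foo] : sigma_finite setT (lebesgue_measure \x mu)%E.
  have /sigma_finiteP[F [TF ndF Foo]] := sigma_finiteT (@lebesgue_measure R).
  have /sigma_finiteP[G [TG ndG Goo]] := sigma_finiteT mu.
  exists (fun k => F k `*` G k).
    rewrite -setXTT TF TG predeqE => -[x y]; split.
      move=> [/= [k _ Fkx] [l _ Gly]]; exists (maxn k l) => //; split.
      - by move: x Fkx; exact/subsetPset/ndF/leq_maxl.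
      - by move: y Gly; exact/subsetPset/ndG/leq_maxr.
    by move=> [k _ []/= ? ?]; split; exists k.
  move=> k; have [? ?] := Foo k; have [? ?] := Goo k.
  split; first exact: measurableX.
  by rewrite product_measure1E// lte_mul_pinfty// ge0_fin_numE.
exists (fun k => uncons_rV @^-1` F k).
  by rewrite -preimage_bigcup -TF preimage_setT.
move=> k; have [mF Fk] := Foo k; split.
  by rewrite -[X in measurable X]setTI; exact: measurable_uncons_rV.
rewrite /lebesgue_rVS /pushforward -comp_preimage.
rewrite (_ : uncons_rV \o cons_rV = id)//.
by apply/funext => p; exact: cons_rVK.
Qed.

HB.instance Definition _ := Measure_isSigmaFinite.Build _ _ _ lebesgue_rVS
  lebesgue_rVS_sigma_finite.

End lebesgue_rV_step.

(* n-dimensional Lebesgue measure: the n-fold product of lebesgue_measure,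
   transported along R * R^n -> R^(n+1) *)
Fixpoint lebesgue_rV (R : realType) (n : nat) :
    {sigma_finite_measure set 'rV[R]_n -> \bar R} :=
  match n return {sigma_finite_measure set 'rV[R]_n -> \bar R} with
  | 0 => \d_(0 : 'rV[R]_0)
  | m.+1 => lebesgue_rVS (lebesgue_rV R m)
  end.

Lemma lebesgue_rV_box (R : realType) (n : nat) (A : 'I_n -> set R) :
  (forall i, measurable (A i : set (measurableTypeR R))) ->
  lebesgue_rV R n [set x | forall i, A i (x ord0 i)] =
  (\prod_(i < n) lebesgue_measure (A i : set (measurableTypeR R)))%E.
Proof.
elim: n A => [|n IH] A mA.
  by rewrite big_ord0 /= diracE mem_set//= => -[].
rewrite big_ord_recl -(IH (fun i => A (lift ord0 i))) => [|i]; last exact: mA.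
pose B := [set x : 'rV[R]_n | forall i, A (lift ord0 i) (x ord0 i)].
have mB : measurable B.
  rewrite (_ : B = \bigcap_(i in [set: 'I_n])
      (fun x : 'rV[R]_n => x ord0 i : measurableTypeR R) @^-1` A (lift ord0 i)).
    apply: fin_bigcap_measurable => // i _.
    rewrite -[X in measurable X]setTI.
    by apply: measurable_coord_rV => //; exact: mA.
  by apply/seteqP; split => [x Bx i _|x Bx i]; [exact: Bx|exact: (Bx i I)].
rewrite -[X in (_ * X)%E]/(lebesgue_rV R n B) -product_measure1E//.
rewrite /= /lebesgue_rVS /pushforward; congr (_ _).
apply/seteqP; split => [p /= Ap|p [/= A0 AS] i].
  split; first by have := Ap ord0; rewrite cons_rV0.
  by move=> i; have := Ap (lift ord0 i); rewrite cons_rVS.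
by case: (unliftP ord0 i) => [j ->|->]; rewrite ?cons_rVS ?cons_rV0//; exact: AS.
Qed.

Section euclidean.
Variables (R : realType) (n : nat).
Implicit Types x y : 'rV[R]_n.

Definition dot x y : R := \sum_(i < n) x ord0 i * y ord0 i.

(* `|x| on 'rV[R]_n is the sup norm, hence this definition *)
Definition enorm x : R := Num.sqrt (dot x x).

Definition gauss x : R :=
  (2 * pi) `^ (- (n%:R / 2)) * expR (- (enorm x ^+ 2 / 2)).

Definition partial (i : 'I_n) (f : 'rV[R]_n -> R) : 'rV[R]_n -> R :=
  'D_(delta_mx ord0 i) f.

Definition grad (f : 'rV[R]_n -> R) x : 'rV[R]_n := \row_i partial i f x.

Definition poly_bounded (f : 'rV[R]_n -> R) : Prop :=
  exists p : mpoly.mpoly n R,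
    forall x, `|f x| <= mpoly.meval (fun i => x ord0 i) p.

(* C^k with polynomial bounds: every iterated partial derivative of order at
   most k exists, is continuous and is bounded by a polynomial *)
Fixpoint C_poly (k : nat) (f : 'rV[R]_n -> R) : Prop :=
  [/\ continuous f, poly_bounded f &
    if k is k'.+1 then
      forall i, (forall x, derivable f x (delta_mx ord0 i)) /\
                C_poly k' (partial i f)
    else True].

End euclidean.

(* convexity for functions with values in (-oo, +oo]; the lower bound also
   rules out the -oo that the library assigns to an integral whose positive
   and negative parts are both infinite *)
Definition econvex (R : realType) (F : R -> \bar R) : Prop :=
  (forall a, -oo < F a)%E /\
  forall (t a b : R), 0 <= t <= 1 ->
    (F (t * a + (1 - t) * b)%R <= t%:E * F a + (1 - t)%:E * F b)%E.

Definition Phi_tilde (R : realType) (Phi : R -> R) (a : R) : \bar R :=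
  ((Num.sqrt (2 * pi))^-1%:E *
   \int[lebesgue_measure]_z
     (Phi (pi / 2 * a * z) * expR (- (z ^+ 2 / 2)))%:E)%E.

(* Main.v *)
Require Import Defs.
From HB Require Import structures.
From mathcomp Require Import all_boot all_order all_algebra.
From mathcomp Require Import all_classical all_reals all_analysis.
From mathcomp Require Import measurable_realfun ring lra.
From mathcomp Require mpoly.

(* Let X, Y be independent standard Gaussian vectors.  Jensen's inequality in Y
   bounds E Phi(f(X) - E f(Y)) by E Phi(f(X) - f(Y)).  Joining Y to X by the
   quarter circle X_t = cos t Y + sin t X, the difference f(X) - f(Y) is the
   integral over [0, pi/2] of the inner product of grad f(X_t) with the
   derivative X'_t, and Jensen's inequality in t moves Phi inside; by rotation
   invariance (X_t, X'_t) has the law of (X, Y) for every t.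
   Since Phi need not be integrable, Phi is first replaced with the nonnegative
   convex function Psi obtained by subtracting its supporting line at 0: the
   arguments of Phi are centered, so this shifts every integral by Phi 0, and
   Tonelli's theorem applies to Psi. *)

(** A quarter circle is used rather than a segment because the position on a segment from Y to X is
    correlated with its velocity X - Y except at the midpoint, whereas (X_t, X'_t) is a rotation of
    (Y, X) and keeps independent standard Gaussian components. The constant pi/2 is the length of
    the parameter interval: Jensen's inequality in t needs a probability measure, so the integral
    over [0, pi/2] is read as pi/2 times a mean. Rotation invariance is reduced to translation
    invariance: a shear is a translation on each fibre, so Tonelli's theorem handles it, and shears
    compose to rotations. The same rotations show that, for fixed x, the inner product of grad f(x)
    with Y is a centred normal variable of standard deviation |grad f(x)|. This gives the two
    equalities, and its symmetry gives the centering used to discard the linear part of Phi. *)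

Set Implicit Arguments.
Unset Strict Implicit.
Unset Printing Implicit Defensive.

Import Order.TTheory GRing.Theory Num.Theory.
Import numFieldNormedType.Exports.

Local Open Scope classical_set_scope.
Local Open Scope ring_scope.

(** * Convex functions and integration *)

Section convex.
Variable R : realType.
Implicit Types (Phi Psi : R -> R).

Definition convexR Phi := forall t a b : R, 0 <= t <= 1 ->
  Phi (t * a + (1 - t) * b) <= t * Phi a + (1 - t) * Phi b.

Lemma convex_functionR Phi : convex_function [set: R] Phi -> convexR Phi.
Proof.
move=> cPhi t a b t01.
have := @cPhi (Itv01 (andP t01).1 (andP t01).2) a b.
by rewrite !inE => /(_ I I).
Qed.

(** The slope is the left derivative at [u], taken as the supremum of the chord slopes on the left.
    Convexity puts each of these below every chord slope on the right, so the supremum exists and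
    works on both sides. *)
Lemma convexR_subgradient Phi (u : R) : convexR Phi ->
  exists s : R, forall t, Phi u + s * (t - u) <= Phi t.
Proof.
move=> cPhi.
have slope a b : a < u -> u < b -> (Phi u - Phi a) / (u - a) <= (Phi b - Phi u) / (b - u).
  move=> au ub; rewrite ler_pdivrMr ?subr_gt0// mulrAC ler_pdivlMr ?subr_gt0//.
  have ba : 0 < b - a by lra.
  (* This weight writes [u] as a convex combination of [a] and [b]. *)
  have := @cPhi ((b - u) / (b - a)) a b.
  have -> : (b - u) / (b - a) * a + (1 - (b - u) / (b - a)) * b = u.
    by field; rewrite gt_eqF.
  move=> /(_ _)/wrap[|].
    by rewrite divr_ge0 ?ler_pdivrMr ?(ltW ba)//; lra.
  rewrite -(ler_pM2r ba).
  have -> : ((b - u) / (b - a) * Phi a + (1 - (b - u) / (b - a)) * Phi b) * (b - a)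
     = (b - u) * Phi a + (u - a) * Phi b by field; rewrite gt_eqF.
  by lra.
pose S := [set (Phi u - Phi a) / (u - a) | a in [set a | a < u]].
have S0 : S !=set0 by exists ((Phi u - Phi (u - 1)) / (u - (u - 1))), (u - 1) => //=; lra.
have Sub b : u < b -> ubound S ((Phi b - Phi u) / (b - u)).
  by move=> ub _ [a /= au <-]; exact: slope.
have hS : has_sup S by split => //; exists ((Phi (u + 1) - Phi u) / (u + 1 - u)); apply: Sub; lra.
exists (sup S) => t; have [tu|ut|->] := ltgtP t u; last by rewrite subrr mulr0 addr0.
- have : (Phi u - Phi t) / (u - t) <= sup S by apply: ub_le_sup; [case: hS|exists t].
  by rewrite ler_pdivrMr ?subr_gt0//; lra.
- have : sup S <= (Phi t - Phi u) / (t - u) by apply: ge_sup => //; exact: Sub.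
  by rewrite ler_pdivlMr ?subr_gt0//; lra.
Qed.

(** Sublevel sets of a convex function are intervals, hence Borel. *)
Lemma convexR_measurable Phi : convexR Phi -> measurable_fun setT Phi.
Proof.
move=> cPhi; apply: (measurability _ (RGenOInfty.measurableE R)) => _ [_ [a ->] <-].
rewrite setTI -[X in measurable X]setCK; apply: measurableC.
rewrite (_ : ~` _ = [set z | Phi z <= a]); last first.
  by apply/seteqP; split => z /=; rewrite in_itv/= andbT leNgt => /negP.
apply: is_interval_measurable => x y /= Px Py z /andP[xz zy].
have [xy|xy] := eqVneq x y; first by have -> : z = x by apply: le_anti; rewrite xz xy zy.
have {}xy : x < y by rewrite lt_neqAle xy (le_trans xz zy).
have yx : 0 < y - x by lra.
have t01 : 0 <= (y - z) / (y - x) <= 1 by rewrite divr_ge0 ?ler_pdivrMr ?(ltW yx)//; lra.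
have := @cPhi _ x y t01.
have -> : (y - z) / (y - x) * x + (1 - (y - z) / (y - x)) * y = z.
  by field; rewrite gt_eqF.
move/le_trans; apply; move: t01; set t := _ / _ => /andP[t0 t1].
by nra.
Qed.

End convex.

(** * Integrals that may be infinite, and Jensen's inequality *)

Section integral.
Local Open Scope ereal_scope.
Context d (T : measurableType d) (R : realType).
Variable mu : {measure set T -> \bar R}.

Lemma ge0_integrable (f : T -> \bar R) : measurable_fun setT f ->
  (forall x, 0 <= f x) -> \int[mu]_x f x < +oo -> mu.-integrable setT f.
Proof.
move=> mf f0 foo; apply/integrableP; split=> //.
by rewrite (eq_integral f)// => x _; rewrite gee0_abs.
Qed.

(** Neither sign nor integrability of [f] is assumed. If the negative part has infinite integral,
    both sides are -oo by the convention +oo - oo = -oo, which multiplication by a positive real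
    preserves. *)
Lemma integralZl_gt0 (k : R) (f : T -> \bar R) : (0 < k)%R ->
  measurable_fun setT f ->
  \int[mu]_x (k%:E * f x) = k%:E * \int[mu]_x f x.
Proof.
move=> k0 mf; rewrite [in LHS]integralE// ge0_funeposM ?ge0_funenegM ?ltW//=.
rewrite (ge0_integralZl_EFin _ _ _ (measurable_funepos mf) (ltW k0))//.
rewrite (ge0_integralZl_EFin _ _ _ (measurable_funeneg mf) (ltW k0))//.
rewrite [in RHS]integralE.
have : 0 <= \int[mu]_x f^\- x by exact: integral_ge0.
move: (\int[mu]_x f^\+ x) (\int[mu]_x f^\- x) => p [b| |] b0; last by [].
  by rewrite muleBr// fin_num_adde_defl.
by rewrite gt0_muley ?lte_fin// !addeNy gt0_muleNy ?lte_fin.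
Qed.

(** The integral of [g] may be +oo. With k = g + h, the nonnegative functions k^+ + h^- and k^- + g
    + h^+ agree pointwise, so their integrals agree; since k^- <= h^-, the integrals to be
    subtracted are finite. *)
Lemma ge0_integralD_integrable (g : T -> \bar R) (h : T -> R) :
  measurable_fun setT g -> (forall x, 0 <= g x) ->
  mu.-integrable setT (EFin \o h) ->
  \int[mu]_x (g x + (h x)%:E) = \int[mu]_x g x + \int[mu]_x (h x)%:E.
Proof.
move=> mg g0 ih; have mh := measurable_int _ ih.
pose k x := g x + (h x)%:E.
have mk : measurable_fun setT k by exact: emeasurable_funD.
have hpfin := integrable_fin_num measurableT (integrable_funepos measurableT ih).
have hnfin := integrable_fin_num measurableT (integrable_funeneg measurableT ih).
have kn_le x : k^\- x <= (EFin \o h)^\- x.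
  rewrite !funenegE /k/=; move: (g0 x); case: (g x) => [a|_|//]/=.
    rewrite !lee_fin -!EFin_max lee_fin => a0.
    by rewrite ge_max !le_max lexx orbT andbT; apply/orP; left; lra.
  by rewrite maxNye le_max lexx orbT.
have knfin : \int[mu]_x k^\- x \is a fin_num.
  rewrite ge0_fin_numE; last exact: integral_ge0.
  apply: (@le_lt_trans _ _ (\int[mu]_x (EFin \o h)^\- x)).
    by apply: ge0_le_integral => //; exact: measurable_funeneg.
  by rewrite -ge0_fin_numE//; exact: integral_ge0.
have key : \int[mu]_x k^\+ x + \int[mu]_x (EFin \o h)^\- x =
    \int[mu]_x k^\- x + (\int[mu]_x g x + \int[mu]_x (EFin \o h)^\+ x).
  rewrite -!ge0_integralD//; try exact: measurable_funeneg; try exact: measurable_funepos.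
  - apply: eq_integral => x _; rewrite !funenegE !funeposE /k/=.
    move: (g0 x); case: (g x) => [a|_|//]/=.
      rewrite lee_fin -!EFin_max -!EFinD => a0; congr EFin.
      by rewrite /Num.max; do !case: ifPn => //; rewrite -?leNgt; lra.
    by rewrite maxNye maxye -!EFin_max !addye// add0e.
  - by move=> x _; rewrite adde_ge0.
  - by apply: emeasurable_funD => //; exact: measurable_funepos.
rewrite -/k -[LHS]/(\int[mu]_x k x) [LHS]integralE [X in _ = _ + X]integralE.
move: hpfin hnfin knfin key.
case: (\int[mu]_x (EFin \o h)^\+ x) => [p||]//; case: (\int[mu]_x (EFin \o h)^\- x) => [q||]//.
case: (\int[mu]_x k^\- x) => [r||]// _ _ _.
case: (\int[mu]_x k^\+ x) => [u||]//; case: (\int[mu]_x g x) => [v||]// [] e.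
by congr EFin; lra.
Qed.

(* Integrate the supporting line of [Psi] at the barycenter. *)
Lemma jensen_weight (Psi : R -> R) (X w : T -> R) (m : R) :
  convexR Psi -> (forall t, (0 <= Psi t)%R) ->
  measurable_fun setT X -> measurable_fun setT w -> (forall x, (0 <= w x)%R) ->
  \int[mu]_x (w x)%:E = 1 ->
  mu.-integrable setT (fun x => (X x * w x)%:E) ->
  \int[mu]_x (X x * w x)%:E = m%:E ->
  (Psi m)%:E <= \int[mu]_x (Psi (X x) * w x)%:E.
Proof.
move=> cPsi Psi0 mX mw w0 w1 iX mE.
have [s sP] := convexR_subgradient m cPsi.
have mPX : measurable_fun setT (fun x => (Psi (X x) * w x)%:E).
  apply/measurable_EFinP; apply: measurable_funM => //.
  by apply: measurableT_comp => //; exact: convexR_measurable.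
have P0 x : 0 <= (Psi (X x) * w x)%:E by rewrite lee_fin mulr_ge0.
have [Pfin|] := ltP (\int[mu]_x (Psi (X x) * w x)%:E) +oo; last first.
  by rewrite leye_eq => /eqP ->; rewrite leey.
have iw : mu.-integrable setT (EFin \o w).
  apply: ge0_integrable => [|x|]; [exact/measurable_EFinP|exact: w0|].
  by rewrite w1 ltry.
have -> : (Psi m)%:E = \int[mu]_x ((Psi m - s * m)%:E * (w x)%:E + s%:E * (X x * w x)%:E).
  rewrite integralD//; try exact: integrableZl.
  by rewrite !integralZl// w1 mE mule1 -EFinM -EFinD; congr EFin; lra.
apply: le_integral => //.
- by apply: integrableD => //; exact: integrableZl.
- exact: ge0_integrable.
- move=> x _; rewrite -!EFinM -EFinD lee_fin mulrA -mulrDl ler_wpM2r//.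
  by apply: le_trans (sP (X x)); lra.
Qed.

End integral.

(** * Translation invariance on the line *)

Section lebesgue_translation.
Variable R : realType.

Lemma lebesgue_measure_translation (a : R) (A : set R) : measurable A ->
  pushforward lebesgue_measure (+%R a : _ -> measurableTypeR R) A = lebesgue_measure A.
Proof.
move=> mA; apply/esym/lebesgue_measure_unique => //=.
  exact: measurable_funD.
move=> _ _ [[x y] _ <-].
rewrite /pushforward (_ : _ @^-1` _ = `](x - a), (y - a)]%classic); last first.
  by apply/seteqP; split => z /=; rewrite !in_itv/= => /andP[? ?]; apply/andP; split; lra.
rewrite !lebesgue_measure_itv/= !lte_fin ltrD2r.
by case: ifPn => // _; rewrite -!EFinD; congr EFin; lra.
Qed.

Lemma ge0_integral_translation (a : R) (F : R -> \bar R) :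
  measurable_fun setT F -> (forall x, 0 <= F x)%E ->
  (\int[lebesgue_measure]_x F (a + x)%R = \int[lebesgue_measure]_x F x)%E.
Proof.
move=> mF F0.
rewrite -[LHS]/(\int[lebesgue_measure]_(x in (+%R a : _ -> measurableTypeR R) @^-1` setT) (F \o +%R a) x)%E.
rewrite -ge0_integral_pushforward//; last exact: measurable_funD.
apply: eq_measure_integral; first exact: measurable_funD.
by move=> mD A mA _; exact: lebesgue_measure_translation.
Qed.

End lebesgue_translation.

(** * Shears of a product space *)

Section shear.
Local Open Scope ereal_scope.
Context d (T : measurableType d) (R : realType).
Variable mu : {sigma_finite_measure set T -> \bar R}.
Variable sh : R -> T -> T -> T.
Hypothesis msh : forall c, measurable_fun setT (fun p : T * T => sh c p.1 p.2).
Hypothesis int_sh : forall c y (F : T -> \bar R), measurable_fun setT F ->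
  (forall x, 0 <= F x) -> \int[mu]_x F (sh c x y) = \int[mu]_x F x.

(** With the second coordinate frozen the shear acts on the first as a translation, which is the
    content of [int_sh]; so the second coordinate is integrated last. Keeping [sh] abstract serves
    both the line and row vectors. *)
Lemma ge0_integral_shear1 c (F : T * T -> \bar R) : measurable_fun setT F ->
  (forall p, 0 <= F p) ->
  \int[mu \x mu]_p F (sh c p.1 p.2, p.2) = \int[mu \x mu]_p F p.
Proof.
move=> mF F0; rewrite fubini_tonelli2//; last first.
  by apply: measurableT_comp mF _; exact: measurable_fun_pair.
apply: etrans (esym (fubini_tonelli2 F mF F0)).
apply: eq_integral => y _; rewrite /fubini_G/=.
by rewrite (int_sh c y (F := fun x => F (x, y)))//; exact: measurable_fun_pair1.
Qed.

Lemma ge0_integral_shear2 c (F : T * T -> \bar R) : measurable_fun setT F ->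
  (forall p, 0 <= F p) ->
  \int[mu \x mu]_p F (p.1, sh c p.2 p.1) = \int[mu \x mu]_p F p.
Proof.
move=> mF F0; rewrite fubini_tonelli1//; last first.
  apply: measurableT_comp mF _; apply: measurable_fun_pair => //.
  by apply: (measurableT_comp (msh c)) (measurable_fun_pair _ _).
apply: etrans (esym (fubini_tonelli1 F mF F0)).
apply: eq_integral => x _; rewrite /fubini_F/=.
by rewrite (int_sh c x (F := fun y => F (x, y)))//; exact: measurable_fun_pair2.
Qed.

(* This is a rotation when [t] is the tangent of half its angle and [s] its sine. *)
Lemma ge0_integral_shear3 t s (F : T * T -> \bar R) : measurable_fun setT F ->
  (forall p, 0 <= F p) ->
  \int[mu \x mu]_p F (let x1 := sh t p.1 p.2 in let y1 := sh (- s)%R p.2 x1 in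
    (sh t x1 y1, y1)) = \int[mu \x mu]_p F p.
Proof.
move=> mF F0.
pose F1 p := F (sh t p.1 p.2, p.2); pose F2 p := F1 (p.1, sh (- s)%R p.2 p.1).
have mF1 : measurable_fun setT F1.
  by apply: measurableT_comp mF _; exact: measurable_fun_pair.
have mF2 : measurable_fun setT F2.
  apply: measurableT_comp mF1 _; apply: measurable_fun_pair => //.
  by apply: (measurableT_comp (msh (- s)%R)) (measurable_fun_pair _ _).
transitivity (\int[mu \x mu]_p F2 (sh t p.1 p.2, p.2)); first by [].
rewrite (ge0_integral_shear1 _ mF2)//; last by move=> p; exact: F0.
rewrite /F2 (ge0_integral_shear2 _ mF1)//; last by move=> p; exact: F0.
by rewrite /F1 ge0_integral_shear1.
Qed.

End shear.

(** * Lebesgue measure on row vectors *)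

Section rV.
Variable R : realType.

Lemma ge0_integral_rVS n (F : 'rV[R]_n.+1 -> \bar R) : measurable_fun setT F ->
  (forall x, 0 <= F x)%E ->
  (\int[lebesgue_rV R n.+1]_x F x =
   \int[lebesgue_measure]_a \int[lebesgue_rV R n]_x F (cons_rV (a, x)))%E.
Proof.
move=> mF F0.
have mc := @measurable_cons_rV R n.
transitivity (\int[lebesgue_measure \x lebesgue_rV R n]_p F (cons_rV p))%E.
  exact: (@ge0_integral_pushforward _ _ _ _ R _ mc (lebesgue_measure \x lebesgue_rV R n)%E setT).
rewrite fubini_tonelli1//.
by apply: measurableT_comp mF _.
Qed.

(** Induction on the dimension: the tail is translated inside by the induction hypothesis, then the
    first coordinate outside by invariance on the line. *)
Lemma ge0_integral_rV_translation n (y : 'rV[R]_n) (F : 'rV[R]_n -> \bar R) :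
  measurable_fun setT F -> (forall x, 0 <= F x)%E ->
  (\int[lebesgue_rV R n]_x F (x + y)%R = \int[lebesgue_rV R n]_x F x)%E.
Proof.
elim: n y F => [|n IH] y F mF F0.
  by apply: eq_integral => x _; congr F; apply/rowP => -[].
have mD k (z : 'rV[R]_k) : measurable_fun setT (fun x : 'rV[R]_k => x + z).
  apply: measurable_fun_rV => i; under eq_fun do rewrite mxE.
  by apply: measurable_funD => //; exact: measurable_coord_rV.
have mFc a : measurable_fun setT (fun x : 'rV[R]_n => F (cons_rV (a, x))).
  apply: measurableT_comp mF _; apply: (measurableT_comp (@measurable_cons_rV R n)).
  exact: measurable_fun_pair.
rewrite ge0_integral_rVS//; last exact: measurableT_comp mF (mD _ _).
apply: etrans (esym (ge0_integral_rVS mF F0)).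
pose y' := \row_i y ord0 (lift ord0 i) : 'rV[R]_n.
transitivity (\int[lebesgue_measure]_a \int[lebesgue_rV R n]_x
    F (cons_rV ((y ord0 ord0 + a)%R, x)))%E.
  apply: eq_integral => a _.
  rewrite -(IH y' (fun x => F (cons_rV ((y ord0 ord0 + a)%R, x))))//.
  apply: eq_integral => x _; congr F; apply/rowP => i; rewrite [LHS]mxE.
  case: (unliftP ord0 i) => [j ->|->]; last by rewrite !cons_rV0/= addrC.
  by rewrite !cons_rVS/= !mxE.
rewrite (ge0_integral_translation (y ord0 ord0) (F := fun a => \int[lebesgue_rV R n]_x
    F (cons_rV (a, x)))%E)//; last by move=> a; exact: integral_ge0.
apply: (measurable_fun_fubini_tonelli_F (fun p => F (cons_rV p))) => //.
exact: (measurableT_comp mF (@measurable_cons_rV R n)).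
Qed.

Lemma measurable_rV_sum d (T : measurableType d) n (f g : T -> 'rV[R]_n) (a b : T -> R) :
  measurable_fun setT f -> measurable_fun setT g ->
  measurable_fun setT a -> measurable_fun setT b ->
  measurable_fun setT (fun t => a t *: f t + b t *: g t).
Proof.
move=> mf mg ma mb; apply: measurable_fun_rV => i.
under eq_fun do rewrite !mxE.
by apply: measurable_funD; apply: measurable_funM => //;
  apply: (measurableT_comp (@measurable_coord_rV R n i)).
Qed.

(* An open set is the union of the rational balls that it contains. *)
Lemma open_measurable_rV n (U : set 'rV[R]_n) : open U -> measurable U.
Proof.
move=> oU.
pose B (q : 'rV[rat]_n * nat) : set 'rV[R]_n :=
  [set x | forall i, `|ratr (q.1 ord0 i) - x ord0 i| < q.2.+1%:R^-1].
have mB q : measurable (B q).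
  rewrite (_ : B q = \bigcap_(i in [set: 'I_n])
      (fun x : 'rV[R]_n => x ord0 i : measurableTypeR R) @^-1` ball (ratr (q.1 ord0 i) : R) (q.2.+1%:R^-1)).
    apply: fin_bigcap_measurable => // i _.
    rewrite -[X in measurable X]setTI.
    by apply: measurable_coord_rV => //; exact: measurable_ball.
  by apply/seteqP; split => [x Bx i _|x Bx i]; [exact: Bx|exact: (Bx i I)].
rewrite (_ : U = \bigcup_(q in [set q | B q `<=` U]) B q).
  rewrite bigcup_mkcond; apply: countable_bigcupT_measurable => [|q]; first exact: countableP.
  by case: ifPn => // _; exact: mB.
apply/seteqP; split => [x Ux|x [q /= qU]]; last exact: qU.
have /nbhs_ballP[e /= e0 eU] : nbhs x U by apply: open_nbhs_nbhs; split.
(* Half of [e], because a point of the box is compared with [x] through the rational centre, at the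
   cost of two radii. *)
have [k ke] : exists k : nat, k.+1%:R^-1 < e / 2.
  have /ltr_add_invr[k] : 0 < e / 2 by rewrite divr_gt0. 
  by rewrite add0r => ?; exists k.
have approx r t : 0 < r -> exists q : rat, `|ratr q - t| < r :> R.
  move=> r0; have /rat_in_itvoo[q] : t - r < t + r by lra.
  by rewrite in_itv/= => /andP[? ?]; exists q; rewrite ltr_norml; apply/andP; split; lra.
have /choice[q qP] := fun i : 'I_n => @approx k.+1%:R^-1 (x ord0 i) (eqbRL (invr_gt0 _) (ltr0Sn _ _)).
exists (\row_i q i, k) => /=; last by move=> i; rewrite /= mxE.
move=> z Bz; apply: eU; split => // i j; rewrite ord1.
have := Bz j; have := qP j; rewrite /= mxE /ball/= => h1 h2.
rewrite (_ : _ - _ = (ratr (q j) - z ord0 j) - (ratr (q j) - x ord0 j)).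
  rewrite (le_lt_trans (ler_normB _ _))// (splitr e).
  by rewrite ltrD// (lt_trans _ ke).
by rewrite opprB [RHS]addrC addrA subrK.
Qed.

Lemma continuous_measurable_rV n (f : 'rV[R]_n -> R) : continuous f -> measurable_fun setT f.
Proof.
move=> /continuousP cf; apply: (measurability _ (RGenOpens.measurableE R)).
move=> _ [_ [a [b ->] <-]]; rewrite setTI; apply: open_measurable_rV.
by apply: cf.
Qed.

End rV.

(** * Rotation invariance *)

(* A rotation that is not a half-turn is a product of three shears, and the
   half-turn is the square of a quarter turn. *)
Section rotation.
Local Open Scope ereal_scope.
Context d (T : measurableType d) (R : realType).
Variable mu : {sigma_finite_measure set T -> \bar R}.
Variables (sh : R -> T -> T -> T) (rot : R -> R -> T * T -> T * T).
Hypothesis msh : forall c, measurable_fun setT (fun p : T * T => sh c p.1 p.2).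
Hypothesis int_sh : forall c y (F : T -> \bar R), measurable_fun setT F ->
  (forall x, 0 <= F x) -> \int[mu]_x F (sh c x y) = \int[mu]_x F x.
Hypothesis mrot : forall c s, measurable_fun setT (rot c s).
Hypothesis rot_shears : forall c s p, (c ^+ 2 + s ^+ 2 = 1)%R -> (1 + c != 0)%R ->
  let t := (s / (1 + c))%R in
  let x1 := sh t p.1 p.2 in let y1 := sh (- s)%R p.2 x1 in
  rot c s p = (sh t x1 y1, y1).
Hypothesis rot_half_turn : forall p, rot (-1) 0 p = rot 0 1 (rot 0 1 p).

Lemma ge0_integral_rotation c s (F : T * T -> \bar R) :
  (c ^+ 2 + s ^+ 2 = 1)%R -> measurable_fun setT F -> (forall p, 0 <= F p) ->
  \int[mu \x mu]_p F (rot c s p) = \int[mu \x mu]_p F p.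
Proof.
move=> cs1.
have key c' s' G : (c' ^+ 2 + s' ^+ 2 = 1)%R -> (1 + c' != 0)%R ->
    measurable_fun setT G -> (forall p, 0 <= G p) ->
    \int[mu \x mu]_p G (rot c' s' p) = \int[mu \x mu]_p G p.
  move=> cs c1 mG G0; apply: etrans (ge0_integral_shear3 msh int_sh (s' / (1 + c')) s' mG G0).
  by apply: eq_integral => p _; rewrite rot_shears.
have [c1|] := eqVneq (1 + c)%R 0%R; last exact: key.
have cE : c = (-1)%R by lra.
have -> : s = 0%R.
  by apply/eqP; rewrite -sqrf_eq0; apply/eqP; move: cs1; rewrite cE; lra.
rewrite cE => mF F0.
have h01 : (0 ^+ 2 + 1 ^+ 2 = 1 :> R)%R by rewrite expr0n expr1n add0r.
have h1 : (1 + 0 != 0 :> R)%R by rewrite addr0 oner_eq0.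
transitivity (\int[mu \x mu]_p F (rot 0 1 (rot 0 1 p))).
  by apply: eq_integral => p _; rewrite rot_half_turn.
rewrite (key 0%R 1%R (fun p => F (rot 0%R 1%R p)))//; first exact: key.
exact: measurableT_comp mF (mrot _ _).
Qed.

End rotation.

(** * Rotations of the plane and of pairs of vectors *)

Section rotations.
Variable R : realType.

(** For t = s / (1 + c), everything follows from the half-angle identities t (1 + c) = s and c = 1 -
    s t; the second comes from s^2 = (1 - c)(1 + c). *)
Lemma rotation_shears (c s a b : R) : c ^+ 2 + s ^+ 2 = 1 -> 1 + c != 0 ->
  let t := s / (1 + c) in let y1 := b + - s * (a + t * b) in
  c * a + s * b = a + t * b + t * y1 /\ - s * a + c * b = y1.
Proof.
move=> cs c1 /=.
have tc : s / (1 + c) * (1 + c) = s by rewrite divfK.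
have st : c = 1 - s * (s / (1 + c)).
  rewrite mulrA -expr2 (_ : s ^+ 2 = (1 - c) * (1 + c)) ?mulfK//; first by ring.
  by rewrite -(addKr (c ^+ 2) (s ^+ 2)) cs; ring.
move: (s / (1 + c)) tc st => t tc st.
have y1 : - s * a + c * b = b + - s * (a + t * b) by rewrite {1}st; ring.
split=> //; rewrite -y1 {1}st -{2}tc; ring.
Qed.

Definition rotR (c s : R) (p : R * R) : R * R :=
  (c * p.1 + s * p.2, - s * p.1 + c * p.2).

(** The signs are chosen so that at (cos t, sin t) the second component is the derivative in t of
    the first: for p = (Y, X) this is the pair (X_t, X'_t). *)
Definition rotV n (c s : R) (p : 'rV[R]_n * 'rV[R]_n) : 'rV[R]_n * 'rV[R]_n :=
  (c *: p.1 + s *: p.2, - s *: p.1 + c *: p.2).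

Lemma measurable_rotR c s : measurable_fun setT (rotR c s).
Proof.
by apply: measurable_fun_pair; apply: measurable_funD; apply: measurable_funM.
Qed.

Lemma measurable_rotV n c s : measurable_fun setT (@rotV n c s).
Proof. by apply: measurable_fun_pair; exact: measurable_rV_sum. Qed.

Lemma ge0_integral_rotR (c s : R) (F : R * R -> \bar R) :
  c ^+ 2 + s ^+ 2 = 1 -> measurable_fun setT F -> (forall p, 0 <= F p)%E ->
  (\int[lebesgue_measure \x lebesgue_measure]_p F (rotR c s p) =
   \int[lebesgue_measure \x lebesgue_measure]_p F p)%E.
Proof.
apply: (@ge0_integral_rotation _ _ R lebesgue_measure (fun c x y => x + c * y)).
- by move=> k; apply: measurable_funD => //; exact: measurable_funM.
- move=> k y G mG G0; rewrite -[RHS](ge0_integral_translation (k * y) mG G0).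
  by apply: eq_integral => x _; rewrite addrC.
- exact: measurable_rotR.
- move=> {}c {}s [x y] cs c1 /=; have [ex ey] := rotation_shears x y cs c1.
  by rewrite /rotR/= ex ey.
- by move=> [x y]; rewrite /rotR/=; congr pair; ring.
Qed.

Lemma ge0_integral_rotV n (c s : R) (F : 'rV[R]_n * 'rV[R]_n -> \bar R) :
  c ^+ 2 + s ^+ 2 = 1 -> measurable_fun setT F -> (forall p, 0 <= F p)%E ->
  (\int[lebesgue_rV R n \x lebesgue_rV R n]_p F (rotV c s p) =
   \int[lebesgue_rV R n \x lebesgue_rV R n]_p F p)%E.
Proof.
apply: (@ge0_integral_rotation _ _ R (lebesgue_rV R n) (fun c x y => x + c *: y)).
- move=> k; under eq_fun do rewrite -[X in X + _]scale1r; exact: measurable_rV_sum.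
- by move=> k y G mG G0; exact: ge0_integral_rV_translation.
- exact: measurable_rotV.
- move=> {}c {}s [x y] cs c1 /=; rewrite /rotV/=.
  by congr pair; apply/rowP => i; rewrite !mxE;
    have [ex ey] := rotation_shears (x ord0 i) (y ord0 i) cs c1.
- by move=> [x y]; rewrite /rotV/=; congr pair; apply/rowP => i; rewrite !mxE; ring.
Qed.

End rotations.

(** * Gaussian densities *)

Section gaussian.
Variable R : realType.

Definition gauss1 (z : R) : R := (Num.sqrt (2 * pi))^-1 * expR (- (z ^+ 2 / 2)).

Lemma gauss1_ge0 z : 0 <= gauss1 z.
Proof. by rewrite mulr_ge0 ?invr_ge0 ?sqrtr_ge0 ?expR_ge0. Qed.

Lemma measurable_gauss1 : measurable_fun setT gauss1.
Proof.
apply: measurable_funM => //; apply: measurableT_comp => //.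
by apply: measurableT_comp => //; apply: measurable_funM => //; exact: measurable_funX.
Qed.

Lemma normal_pdf1E m z : normal_pdf m 1 z = gauss1 (z - m).
Proof.
rewrite normal_pdfE ?oner_eq0// /normal_peak /normal_fun /gauss1 expr1n mul1r.
by rewrite -[pi *+ 2]mulr_natl mulNr.
Qed.

Lemma integral_gauss1 : (\int[lebesgue_measure]_z (gauss1 z)%:E = 1)%E.
Proof.
rewrite -[RHS](@integral_normal_pdf R 0 1); apply: eq_integral => z _.
by rewrite normal_pdf1E subr0.
Qed.

(** Completing the square, e^z and e^(-z) times the standard density are e^(1/2) times the normal
    densities of means 1 and -1, and e^|z| <= e^z + e^(-z). *)
Lemma integral_expR_gauss1 :
  (\int[lebesgue_measure]_z (expR `|z| * gauss1 z)%:E < +oo)%E.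
Proof.
pose g m z : \bar R := ((expR 2^-1)%:E * (normal_pdf m 1 z)%:E)%E.
have mg m : measurable_fun setT (g m).
  by apply: measurable_funeM; apply/measurable_EFinP; exact: measurable_normal_pdf.
have g0 m z : (0 <= g m z)%E by rewrite mule_ge0// lee_fin ?expR_ge0 ?normal_pdf_ge0.
have gE m z : m ^+ 2 = 1 -> g m z = (expR (m * z) * gauss1 z)%:E.
  move=> m1; rewrite /g normal_pdf1E -EFinM /gauss1; congr EFin.
  rewrite mulrCA [RHS]mulrCA -!expRD; congr (_ * expR _).
  by rewrite sqrrB m1; lra.
apply: (@le_lt_trans _ _ (\int[lebesgue_measure]_z (g 1%R z + g (-1)%R z)%E)%E).
  apply: ge0_le_integral => //.
  - by move=> z _; rewrite lee_fin mulr_ge0 ?expR_ge0 ?gauss1_ge0.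
  - apply/measurable_EFinP; apply: measurable_funM; last exact: measurable_gauss1.
    by apply: measurableT_comp => //; exact: measurableT_comp.
  - by apply: emeasurable_funD; exact: mg.
  - move=> z _; rewrite !gE ?expr1n ?sqrrN ?expr1n// -EFinD lee_fin -mulrDl.
    rewrite ler_wpM2r ?gauss1_ge0// mul1r mulN1r.
    by have [z0|z0] := ger0P z; rewrite ?lerDl ?lerDr expR_ge0.
have gfin m : (\int[lebesgue_measure]_z g m z = (expR 2^-1)%:E)%E.
  rewrite ge0_integralZl_EFin ?expR_ge0//.
  - by rewrite integral_normal_pdf mule1.
  - by move=> z _; rewrite lee_fin normal_pdf_ge0.
  - by apply/measurable_EFinP; exact: measurable_normal_pdf.
rewrite ge0_integralD//; [|exact: mg|exact: mg].
by rewrite !gfin ltry.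
Qed.

Lemma dot_cons k (v : 'rV[R]_k.+1) (a : R) (x : 'rV[R]_k) :
  dot v (cons_rV (a, x)) = v ord0 ord0 * a + dot (\row_i v ord0 (lift ord0 i)) x.
Proof.
rewrite /dot big_ord_recl cons_rV0; congr (_ + _).
by apply: eq_bigr => i _; rewrite cons_rVS mxE.
Qed.

Lemma enorm_sqr k (x : 'rV[R]_k) : enorm x ^+ 2 = dot x x.
Proof. by rewrite sqr_sqrtr// sumr_ge0// => i _; rewrite -expr2 sqr_ge0. Qed.

Lemma gauss_prod n (x : 'rV[R]_n) : gauss x = \prod_(i < n) gauss1 (x ord0 i).
Proof.
rewrite /gauss big_split/= -expR_sum enorm_sqr; congr (_ * expR _).
  rewrite prodr_const card_ord powRN [n%:R / 2]mulrC powRrM powR12_sqrt.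
    by rewrite powR_mulrn ?sqrtr_ge0// exprVn.
  by rewrite mulr_ge0// pi_ge0.
by rewrite /dot mulr_suml sumrN; congr (- _); apply: eq_bigr => i _; rewrite expr2.
Qed.

Lemma gauss_cons n a (x : 'rV[R]_n) : gauss (cons_rV (a, x)) = gauss1 a * gauss x.
Proof.
rewrite !gauss_prod big_ord_recl cons_rV0; congr (_ * _).
by apply: eq_bigr => i _; rewrite cons_rVS.
Qed.

Lemma gauss_ge0 n (x : 'rV[R]_n) : 0 <= gauss x.
Proof. by rewrite gauss_prod prodr_ge0// => i _; exact: gauss1_ge0. Qed.

Lemma gauss_gt0 n (x : 'rV[R]_n) : 0 < gauss x.
Proof. by rewrite /gauss mulr_gt0 ?expR_gt0// powR_gt0 ?mulr_gt0// pi_gt0. Qed.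

Lemma measurable_prod_coord n (h : R -> R) : measurable_fun setT h ->
  measurable_fun setT (fun x : 'rV[R]_n => \prod_(i < n) h (x ord0 i)).
Proof.
move=> mh; apply: measurable_prod => i _.
exact: (measurableT_comp mh (@measurable_coord_rV R n i)).
Qed.

Lemma measurable_gauss n : measurable_fun setT (@gauss R n).
Proof.
rewrite (_ : @gauss R n = fun x => \prod_(i < n) gauss1 (x ord0 i)).
  by apply: measurable_prod_coord; exact: measurable_gauss1.
by apply/funext => x; exact: gauss_prod.
Qed.

Lemma integral_prod_coord n (h : R -> R) (c : R) : measurable_fun setT h ->
  (forall z, 0 <= h z) -> (\int[lebesgue_measure]_z (h z)%:E = c%:E)%E ->
  (\int[lebesgue_rV R n]_x (\prod_(i < n) h (x ord0 i))%:E = (c ^+ n)%:E)%E.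
Proof.
move=> mh h0 hc.
have p0 k (x : 'rV[R]_k) : (0 <= (\prod_(i < k) h (x ord0 i))%:E)%E.
  by rewrite lee_fin prodr_ge0.
elim: n => [|n IH].
  rewrite /= integral_dirac//; last first.
    by apply/measurable_EFinP; exact: measurable_prod_coord.
  by rewrite diracT mul1e big_ord0 expr0.
rewrite ge0_integral_rVS//; last first.
  by apply/measurable_EFinP; exact: measurable_prod_coord.
transitivity (\int[lebesgue_measure]_z ((c ^+ n)%:E * (h z)%:E))%E.
  apply: eq_integral => z _; rewrite muleC -IH.
  rewrite -ge0_integralZl_EFin//; last first.
    by apply/measurable_EFinP; exact: measurable_prod_coord.
  apply: eq_integral => x _; rewrite -EFinM; congr EFin.
  rewrite big_ord_recl cons_rV0; congr (_ * _).
  by apply: eq_bigr => i _; rewrite cons_rVS.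
have cn0 : 0 <= c.
  by rewrite -lee_fin -hc; apply: integral_ge0 => z _; rewrite lee_fin.
rewrite ge0_integralZl_EFin ?exprn_ge0//; first by rewrite hc -EFinM exprSr.
by move=> z _; rewrite lee_fin.
exact/measurable_EFinP.
Qed.

Lemma integral_gauss n : (\int[lebesgue_rV R n]_x (gauss x)%:E = 1)%E.
Proof.
under eq_integral do rewrite gauss_prod.
rewrite (integral_prod_coord n measurable_gauss1 gauss1_ge0 integral_gauss1).
by rewrite expr1n.
Qed.

(** The exponential of the l^1 norm, kept as a product so that its Gaussian integral factors over
    the coordinates. It is the common dominating function: it bounds every polynomial up to a
    constant and is integrable against [gauss]. *)
Definition expl1 n (x : 'rV[R]_n) : R := \prod_(i < n) expR `|x ord0 i|.

Lemma expl1_ge0 n (x : 'rV[R]_n) : 0 <= expl1 x.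
Proof. by apply: prodr_ge0 => i _; exact: expR_ge0. Qed.

Lemma measurable_expR_norm : measurable_fun setT (fun z : R => expR `|z|).
Proof. by apply: measurableT_comp => //; exact: measurableT_comp. Qed.

Lemma integral_expl1_gauss n :
  (\int[lebesgue_rV R n]_x (expl1 x * gauss x)%:E < +oo)%E.
Proof.
have h0 (z : R) : 0 <= expR `|z| * gauss1 z by rewrite mulr_ge0 ?expR_ge0 ?gauss1_ge0.
have mh : measurable_fun setT (fun z : R => expR `|z| * gauss1 z).
  by apply: measurable_funM; [exact: measurable_expR_norm|exact: measurable_gauss1].
have [c hc] : exists c, (\int[lebesgue_measure]_z (expR `|z| * gauss1 z)%:E = c%:E)%E.
  exists (fine (\int[lebesgue_measure]_z (expR `|z| * gauss1 z)%:E)%E).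
  rewrite fineK// ge0_fin_numE; first exact: integral_expR_gauss1.
  by apply: integral_ge0 => z _; rewrite lee_fin.
under eq_integral do rewrite gauss_prod -big_split/=.
by rewrite (integral_prod_coord n mh h0 hc) ltry.
Qed.

Lemma measurable_expl1 n : measurable_fun setT (@expl1 n).
Proof. exact: measurable_prod_coord measurable_expR_norm. Qed.

Lemma expl1_bound_gauss_integrable n (h : 'rV[R]_n -> R) (C : R) :
  measurable_fun setT h -> (forall x, `|h x| <= C * expl1 x) ->
  (lebesgue_rV R n).-integrable setT (fun x => (h x * gauss x)%:E).
Proof.
move=> mh hC.
have ie : (lebesgue_rV R n).-integrable setT (fun x => (expl1 x * gauss x)%:E).
  apply: ge0_integrable; last exact: integral_expl1_gauss.
    apply/measurable_EFinP; apply: measurable_funM; first exact: measurable_expl1.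
    exact: measurable_gauss.
  by move=> x; rewrite lee_fin mulr_ge0 ?expl1_ge0 ?gauss_ge0.
apply: (le_integrable measurableT _ _ (integrableZl measurableT C ie)).
  by apply/measurable_EFinP; apply: measurable_funM => //; exact: measurable_gauss.
move=> x _; move: (gauss x) => g; rewrite -EFinM !abse_EFin lee_fin mulrA [leLHS]normrM [leRHS]normrM.
by apply: ler_wpM2r => //; exact: le_trans (hC x) (ler_norm _).
Qed.

Lemma normX_le_expR (z : R) k : `|z| ^+ k <= k`!%:R * expR `|z|.
Proof.
case: k => [|k]; first by rewrite expr0 mul1r -expR0 ler_expR.
have := @expR_ge1Dxn R `|z| k (normr_ge0 z).
rewrite -ler_pdivrMl ?ltr0n ?fact_gt0// mulrC; lra.
Qed.

Lemma poly_bounded_expl1 n (f : 'rV[R]_n -> R) : poly_bounded f ->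
  exists C : R, forall x, `|f x| <= C * expl1 x.
Proof.
move=> [p fp].
(* Each factor |x_i|^k of a monomial is at most k! e^|x_i| by one term of the exponential series;
   the factorials go into the constant. *)
exists (\sum_(m <- mpoly.msupp p) `|mpoly.mcoeff m p| *
  \prod_(i < n) (mpoly.fun_of_multinom m i)`!%:R) => x.
rewrite (le_trans (fp x))// mpoly.mevalE (le_trans (ler_norm _))//.
rewrite (le_trans (ler_norm_sum _ _ _))// mulr_suml ler_sum// => m _.
rewrite normrM -mulrA ler_wpM2l// normr_prod -big_split/=.
apply: ler_prod => i _; rewrite normr_ge0/= normrX; exact: normX_le_expR.
Qed.

End gaussian.

(** * Linear images of a Gaussian vector *)

Section marginal.
Variable R : realType.
Implicit Types (H : R -> R) (c s : R).

Lemma gauss1_rotR c s (x y : R) : c ^+ 2 + s ^+ 2 = 1 ->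
  gauss1 (c * x + s * y) * gauss1 (- s * x + c * y) = gauss1 x * gauss1 y.
Proof.
move=> cs; rewrite /gauss1 mulrACA [RHS]mulrACA -!expRD; congr (_ * expR _).
have : (c * x + s * y) ^+ 2 + (- s * x + c * y) ^+ 2 = x ^+ 2 + y ^+ 2.
  transitivity ((c ^+ 2 + s ^+ 2) * (x ^+ 2 + y ^+ 2)); first by ring.
  by rewrite cs mul1r.
by lra.
Qed.

Lemma gauss_rotV n c s (p : 'rV[R]_n * 'rV[R]_n) : c ^+ 2 + s ^+ 2 = 1 ->
  gauss (rotV c s p).1 * gauss (rotV c s p).2 = gauss p.1 * gauss p.2.
Proof.
move=> cs; rewrite !gauss_prod -!big_split/=; apply: eq_bigr => i _.
by rewrite !mxE; exact: gauss1_rotR.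
Qed.

Lemma unit_vector_decomposition (v w : R) :
  exists c s, [/\ c ^+ 2 + s ^+ 2 = 1, v = Num.sqrt (v ^+ 2 + w ^+ 2) * c &
                  w = Num.sqrt (v ^+ 2 + w ^+ 2) * s].
Proof.
set r := Num.sqrt _.
have vw0 : 0 <= v ^+ 2 + w ^+ 2 by rewrite addr_ge0 ?sqr_ge0.
have rE : r ^+ 2 = v ^+ 2 + w ^+ 2 by rewrite sqr_sqrtr.
have [r0|r0] := eqVneq r 0; last first.
  exists (v / r), (w / r); split; last 2 first.
  - by rewrite mulrCA divff ?mulr1.
  - by rewrite mulrCA divff ?mulr1.
  by rewrite !expr_div_n -mulrDl -rE divff// sqrf_eq0.
(* For the zero vector any direction will do. *)
exists 1, 0; rewrite r0 !mul0r expr1n expr0n addr0; split => //.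
  by apply/eqP; rewrite -sqrf_eq0; apply/eqP; move: rE (sqr_ge0 v) (sqr_ge0 w); rewrite r0; lra.
by apply/eqP; rewrite -sqrf_eq0; apply/eqP; move: rE (sqr_ge0 v) (sqr_ge0 w); rewrite r0; lra.
Qed.

(** With (v, w) = r (c, s), the argument v a + w z is r times the first coordinate of the rotated
    pair. The rotation preserves both Lebesgue measure and the product density, and the second
    coordinate then integrates to 1. *)
Lemma gauss1_marginal2 H (v w : R) : measurable_fun setT H -> (forall t, 0 <= H t) ->
  (\int[lebesgue_measure]_a \int[lebesgue_measure]_z
     (H (v * a + w * z) * gauss1 a * gauss1 z)%:E =
   \int[lebesgue_measure]_z (H (Num.sqrt (v ^+ 2 + w ^+ 2) * z) * gauss1 z)%:E)%E.
Proof.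
move=> mH H0; have [c [s [cs vE wE]]] := unit_vector_decomposition v w.
set r := Num.sqrt _ in vE wE *.
pose F (p : R * R) := (H (r * p.1) * (gauss1 p.1 * gauss1 p.2))%:E.
have F0 p : (0 <= F p)%E by rewrite lee_fin !mulr_ge0 ?gauss1_ge0.
have mg1 : measurable_fun setT (@gauss1 R \o (fst : R * R -> R)).
  by apply: measurableT_comp => //; exact: measurable_gauss1.
have mg2 : measurable_fun setT (@gauss1 R \o (snd : R * R -> R)).
  by apply: measurableT_comp => //; exact: measurable_gauss1.
have mF : measurable_fun setT F.
  apply/measurable_EFinP; apply: measurable_funM; last exact: measurable_funM.
  by apply: measurableT_comp => //; exact: measurable_funM.
transitivity (\int[lebesgue_measure \x lebesgue_measure]_p F (rotR c s p))%E.
  have mFr : measurable_fun setT (fun p => F (rotR c s p)).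
    by apply: measurableT_comp mF _; exact: measurable_rotR.
  have F0r p : (0 <= F (rotR c s p))%E by exact: F0.
  rewrite (fubini_tonelli1 (m1 := lebesgue_measure) (m2 := lebesgue_measure) _ mFr F0r).
  apply: eq_integral => a _; apply: eq_integral => z _.
  rewrite /F/= gauss1_rotR// mulrA; congr ((H _ * _ * _)%:E).
  by rewrite mulrDr !mulrA -vE -wE.
rewrite ge0_integral_rotR// fubini_tonelli1//.
apply: eq_integral => x _; rewrite /fubini_F/F/=.
transitivity (\int[lebesgue_measure]_z ((H (r * x) * gauss1 x)%:E * (gauss1 z)%:E))%E.
  by apply: eq_integral => z _; rewrite mulrA EFinM.
rewrite ge0_integralZl_EFin ?mulr_ge0 ?gauss1_ge0//.
- by rewrite integral_gauss1 mule1.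
- by move=> z _; rewrite lee_fin gauss1_ge0.
- by apply/measurable_EFinP; exact: measurable_gauss1.
Qed.

(** The marginal with coefficients (-1, 0) depends only on their Euclidean norm, which is 1; the
    sign is thereby lost. *)
Lemma gauss1_even H : measurable_fun setT H -> (forall t, 0 <= H t) ->
  (\int[lebesgue_measure]_z (H (- z) * gauss1 z)%:E =
   \int[lebesgue_measure]_z (H z * gauss1 z)%:E)%E.
Proof.
move=> mH H0; have := gauss1_marginal2 (-1) 0 mH H0.
rewrite sqrrN expr1n expr0n addr0 sqrtr1.
under [X in _ = X -> _]eq_integral do rewrite mul1r.
move=> <-; apply: eq_integral => a _.
transitivity (\int[lebesgue_measure]_z ((H (- a) * gauss1 a)%:E * (gauss1 z)%:E))%E; last first.
  by apply: eq_integral => z _; rewrite mulN1r mul0r addr0 EFinM.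
rewrite ge0_integralZl_EFin ?mulr_ge0 ?gauss1_ge0//.
- by rewrite integral_gauss1 mule1.
- by move=> z _; rewrite lee_fin gauss1_ge0.
- by apply/measurable_EFinP; exact: measurable_gauss1.
Qed.

Lemma measurable_dotr n (v : 'rV[R]_n) : measurable_fun setT (dot v).
Proof.
apply: measurable_sum => i; apply: measurable_funM => //; exact: measurable_coord_rV.
Qed.

(** Induction on the dimension, with [H] general: for a fixed first coordinate [a] the induction
    hypothesis applies to H shifted by [v0 * a], and the two-variable case merges [v0] with the norm
    of the tail. *)
Lemma gauss_marginal n (v : 'rV[R]_n) H : measurable_fun setT H -> (forall t, 0 <= H t) ->
  (\int[lebesgue_rV R n]_y (H (dot v y) * gauss y)%:E =
   \int[lebesgue_measure]_z (H (enorm v * z) * gauss1 z)%:E)%E.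
Proof.
elim: n v H => [|n IH] v H mH H0.
  have d0 (x : 'rV[R]_0) : dot v x = 0 by rewrite /dot big_ord0.
  have n0 : enorm v = 0 by rewrite /enorm /dot big_ord0 sqrtr0.
  transitivity ((H 0)%:E * \int[lebesgue_measure]_z (gauss1 z)%:E)%E.
    rewrite integral_gauss1 -(integral_gauss R 0).
    rewrite -ge0_integralZl_EFin//.
    - by apply: eq_integral => x _; rewrite d0 EFinM.
    - by move=> z _; rewrite lee_fin gauss_ge0.
    - by apply/measurable_EFinP; exact: measurable_gauss.
  rewrite -ge0_integralZl_EFin//.
  - by apply: eq_integral => x _; rewrite n0 mul0r EFinM.
  - by move=> z _; rewrite lee_fin gauss1_ge0.
  - by apply/measurable_EFinP; exact: measurable_gauss1.
pose v' := \row_i v ord0 (lift ord0 i) : 'rV[R]_n; pose v0 := v ord0 ord0.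
have HG0 k (h : 'rV[R]_k -> R) x : (0 <= (H (h x) * gauss x)%:E)%E.
  by rewrite lee_fin mulr_ge0 ?gauss_ge0.
rewrite ge0_integral_rVS; last 2 first.
- apply/measurable_EFinP; apply: measurable_funM; last exact: measurable_gauss.
  by apply: measurableT_comp => //; exact: measurable_dotr.
- by move=> x; exact: HG0.
have -> : enorm v = Num.sqrt (v0 ^+ 2 + enorm v' ^+ 2).
  rewrite enorm_sqr /enorm {1}/dot big_ord_recl -expr2; congr (Num.sqrt (_ + _)).
  by apply: eq_bigr => i _; rewrite !mxE.
rewrite -gauss1_marginal2//; apply: eq_integral => a _.
have mHa : measurable_fun setT (fun t => H (v0 * a + t)).
  by apply: measurableT_comp => //; exact: measurable_funD.
transitivity ((gauss1 a)%:E * \int[lebesgue_rV R n]_x (H (v0 * a + dot v' x)%R * gauss x)%:E)%E.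
  rewrite -ge0_integralZl_EFin ?gauss1_ge0//.
  - apply: eq_integral => x _; rewrite dot_cons gauss_cons -EFinM; congr EFin.
    by rewrite mulrCA.
  - by move=> x _; exact: (HG0 n (fun x => v0 * a + dot v' x)).
  - apply/measurable_EFinP; apply: measurable_funM; last exact: measurable_gauss.
    by apply: (measurableT_comp mHa); exact: measurable_dotr.
rewrite (IH v' (fun t => H (v0 * a + t)))// -ge0_integralZl_EFin ?gauss1_ge0//.
- by apply: eq_integral => z _; rewrite -EFinM mulrCA mulrA.
- by move=> z _; rewrite lee_fin mulr_ge0 ?gauss1_ge0.
- apply/measurable_EFinP; apply: measurable_funM; last exact: measurable_gauss1.
  by apply: (measurableT_comp mHa); exact: measurable_funM.
Qed.

End marginal.

(** * Differentiation along curves *)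

Section calculus.
Variable R : realType.

Lemma is_derive_line n (f : 'rV[R]_n -> R) (u v : 'rV[R]_n) (t : R) :
  derivable f (u + t *: v) v ->
  is_derive t 1 (fun t : R => f (u + t *: v)) ('D_v f (u + t *: v)).
Proof.
move=> df.
have e : (fun h : R => h^-1 *: (((fun t : R => f (u + t *: v)) \o shift t) (h *: 1) - f (u + t *: v)))
    = (fun h : R => h^-1 *: ((f \o shift (u + t *: v)) (h *: v) - f (u + t *: v))).
  apply/funext => h /=; congr (_ *: (f _ - _)).
  by rewrite scalerDl addrCA [h *: 1]mulr1.
split; first by rewrite /derivable e.
by rewrite /derive e.
Qed.

Lemma mean_value0 (g dg : R -> R) (k : R) :
  (forall t : R, is_derive t 1 g (dg t)) ->
  exists2 t, `|t| <= `|k| & g k - g 0 = k * dg t.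
Proof.
move=> dgE.
have cg a b : {within `[a, b], continuous g}.
  by apply: derivable_within_continuous => t _.
have [k0|k0] := leP 0 k.
  have [t] := MVT_segment k0 (fun t _ => dgE t) (cg _ _).
  rewrite in_itv/= => /andP[t0 tk] ->; exists t; last by rewrite subr0 mulrC.
  by rewrite !ger0_norm.
have [t] := MVT_segment (ltW k0) (fun t _ => dgE t) (cg _ _).
rewrite in_itv/= => /andP[t0 tk] e; exists t.
  by rewrite !ler0_norm ?lerN2// ltW.
by rewrite -opprB e sub0r mulrN opprK mulrC.
Qed.

(* Move from [x] to [x + k] one coordinate at a time. *)
Lemma mean_value_rV n (f : 'rV[R]_n -> R) (x k : 'rV[R]_n) :
  (forall i x, derivable f x (delta_mx ord0 i)) ->
  exists xi : 'I_n -> 'rV[R]_n,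
    (forall i j, `|xi i ord0 j - x ord0 j| <= `|k ord0 j|) /\
    f (x + k) - f x = \sum_i k ord0 i * partial i f (xi i).
Proof.
move=> df.
(* The path agrees with [x + k] on the first [m] coordinates and with [x] on the others; consecutive
   points differ along one axis, where the scalar mean value theorem applies, and the increments
   telescope. *)
pose u m : 'rV[R]_n := x + \row_j (if (j < m)%N then k ord0 j else 0).
have step (i : 'I_n) : exists t, `|t| <= `|k ord0 i| /\
    f (u i.+1) - f (u i) = k ord0 i * partial i f (u i + t *: delta_mx ord0 i).
  have [|t tk e] := @mean_value0 (fun t => f (u i + t *: delta_mx ord0 i))
      (fun t => partial i f (u i + t *: delta_mx ord0 i)) (k ord0 i).
    by move=> t; exact: is_derive_line.
  exists t; split => //; rewrite -e scale0r addr0; congr (f _ - _).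
  apply/rowP => j; rewrite !mxE/= ltnS leq_eqVlt val_eqE.
  have [->|ji] := eqVneq j i; first by rewrite ltnn mulr1 addr0.
  by rewrite mulr0 addr0.
have /choice[t tP] := step.
exists (fun i : 'I_n => u i + t i *: delta_mx ord0 i); split.
  move=> i j; rewrite !mxE/=; have [->|ji] := eqVneq j i.
    by rewrite ltnn addr0 mulr1 addrAC subrr add0r; case: (tP i).
  rewrite mulr0 addr0 addrAC subrr add0r.
  by case: ifP => _ //; rewrite normr0.
transitivity (f (u n) - f (u 0%N)).
  congr (f _ - f _); apply/rowP => j; rewrite !mxE/= ?ltn_ord//.
  by rewrite addr0.
rewrite -(telescope_sumr (f \o u))// big_mkord.
by apply: eq_bigr => i _; case: (tP i).
Qed.

Lemma cvg_rV (T : Type) (F : set_system T) (FF : Filter F) n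
    (c : T -> 'rV[R]_n) (l : 'rV[R]_n) :
  (forall j, c t ord0 j @[t --> F] --> l ord0 j) -> c t @[t --> F] --> l.
Proof.
move=> cl; apply/cvg_ballP => e e0; near=> t; split=> // i j; rewrite ord1.
move: j; near: t; apply: filter_forall => j.
by have /cvg_ballP/(_ e e0) := cl j.
Unshelve. all: by end_near. Qed.

(** Chain rule from continuous partials alone: the increment of [f] is a sum of coordinate
    increments times partials at intermediate points, and these points tend to [c s] because they
    are squeezed coordinatewise by the increment of [c]. *)
Lemma is_derive_comp_rV n (f : 'rV[R]_n -> R) (c : R -> 'rV[R]_n) (c' : 'rV[R]_n) (s : R) :
  (forall i x, derivable f x (delta_mx ord0 i)) ->
  (forall i, continuous (partial i f)) ->
  (forall j, is_derive s 1 (fun t => c t ord0 j) (c' ord0 j)) ->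
  is_derive s 1 (f \o c) (dot (grad f (c s)) c').
Proof.
move=> df cf dc.
have /choice[xi xiP] := fun h : R => @mean_value_rV n f (c s) (c (h + s) - c s) df.
have kE j h : (c (h + s) - c s) ord0 j = c (h + s) ord0 j - c s ord0 j by rewrite !mxE.
have qcvg j : h^-1 * (c (h + s) - c s) ord0 j @[h --> 0^'] --> c' ord0 j.
  have : (fun h : R => h^-1 *: (((fun t => c t ord0 j) \o shift s) (h *: 1) - c s ord0 j)) @ 0^' --> c' ord0 j.
    by rewrite -(@derive_val _ _ _ _ _ _ _ (dc j)); exact: (@ex_derive _ _ _ _ _ _ _ (dc j)).
  apply: cvg_trans; apply: near_eq_cvg; apply: nearW => h /=.
  by rewrite kE [h *: 1]mulr1.
(* Each increment is [h] times a convergent difference quotient. *)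
have kcvg j : (c (h + s) - c s) ord0 j @[h --> 0^'] --> (0 : R).
  have : h * (h^-1 * (c (h + s) - c s) ord0 j) @[h --> 0^'] --> 0 * c' ord0 j.
    by apply: cvgM (qcvg j); exact: nbhs_dnbhs.
  rewrite mul0r; apply: cvg_trans; apply: near_eq_cvg; near=> h.
  by rewrite mulVKf//; near: h; exact: nbhs_dnbhs_neq.
have xicvg i : xi h i @[h --> 0^'] --> c s.
  apply: cvg_rV => j.
  apply/cvgrPdist_le => e e0; near=> h; rewrite distrC.
  apply: le_trans ((xiP h).1 i j) _; near: h.
  by have /cvgr0_norm_le := kcvg j; apply.
have main : h^-1 *: ((f \o c \o shift s) (h *: 1) - (f \o c) s) @[h --> 0^'] -->
    dot (grad f (c s)) c'.
  rewrite (_ : (fun _ => _) =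
    fun h => \sum_i (partial i f (xi h i) * (h^-1 * (c (h + s) - c s) ord0 i))); last first.
    apply/funext => h /=; rewrite [h *: 1]mulr1.
    have := (xiP h).2; rewrite addrCA subrr addr0 => ->.
    rewrite scaler_sumr; apply: eq_bigr => i _.
    by rewrite [LHS]mulrCA mulrC mulrA [RHS]mulrC mulrA; ring.
  rewrite /dot; apply: (cvg_big add_continuous) => i _; apply: cvgM => //.
  rewrite mxE; apply: cvg_comp (xicvg i) _; exact: cf.
split; first by apply/cvg_ex; exists (dot (grad f (c s)) c').
exact: cvg_lim.
Unshelve. all: by end_near. Qed.

Lemma is_derive_rotV n (p : 'rV[R]_n * 'rV[R]_n) (t : R) j :
  is_derive t 1 (fun t => (rotV (cos t) (sin t) p).1 ord0 j)
    ((rotV (cos t) (sin t) p).2 ord0 j).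
Proof.
rewrite (_ : (fun _ => _) = p.1 ord0 j *: (@cos R) + p.2 ord0 j *: (@sin R)); last first.
  by apply/funext => u; rewrite !mxE; congr (_ + _); exact: mulrC.
have dcos := is_deriveZ (p.1 ord0 j) (is_derive_cos t).
have dsin := is_deriveZ (p.2 ord0 j) (is_derive_sin t).
apply: (is_derive_eq (is_deriveD dcos dsin)).
by rewrite !mxE /GRing.scale/=; ring.
Qed.

Lemma continuous_rotV n (p : 'rV[R]_n * 'rV[R]_n) :
  continuous (fun t : R => (rotV (cos t) (sin t) p).1) /\
  continuous (fun t : R => (rotV (cos t) (sin t) p).2).
Proof.
split=> t; apply: cvg_rV => j; rewrite mxE.
all: under eq_fun do rewrite !mxE.
all: rewrite !mxE; apply: cvgD; apply: cvgMl.
all: try (apply: cvgN); by [exact: continuous_cos|exact: continuous_sin].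
Qed.

Lemma continuous_arc n (f : 'rV[R]_n -> R) (p : 'rV[R]_n * 'rV[R]_n) :
  (forall i, continuous (partial i f)) ->
  continuous (fun t : R => dot (grad f (rotV (cos t) (sin t) p).1) (rotV (cos t) (sin t) p).2).
Proof.
move=> cf t; have [c1 c2] := continuous_rotV p.
apply: (cvg_big add_continuous) => i _; apply: cvgM.
  rewrite mxE; under eq_fun do rewrite mxE.
  apply: (@continuous_comp _ _ _ (fun t => (rotV (cos t) (sin t) p).1) (partial i f)).
    exact: c1.
  exact: cf.
apply: (@continuous_comp _ _ _ (fun t => (rotV (cos t) (sin t) p).2) (fun x => x ord0 i)).
  exact: c2.
exact: coord_continuous.
Qed.

(** The arc starts at [p.1], ends at [p.2], and its velocity is the second component of [rotV]; the
    integrand is thus the derivative of [f] along it. *)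
Lemma integral_arc n (f : 'rV[R]_n -> R) (p : 'rV[R]_n * 'rV[R]_n) :
  (forall i x, derivable f x (delta_mx ord0 i)) ->
  (forall i, continuous (partial i f)) ->
  (\int[lebesgue_measure]_(t in `[0%R, (pi / 2)%R])
    (dot (grad f (rotV (cos t) (sin t) p).1) (rotV (cos t) (sin t) p).2)%:E =
   (f p.2 - f p.1)%:E)%E.
Proof.
move=> df cf.
pose F (t : R) := f (rotV (cos t) (sin t) p).1.
have dF (t : R) : is_derive t 1 F (dot (grad f (rotV (cos t) (sin t) p).1) (rotV (cos t) (sin t) p).2).
  apply: (@is_derive_comp_rV n f (fun t => (rotV (cos t) (sin t) p).1)) => // j.
  exact: is_derive_rotV.
have cF (t : R) : F u @[u --> t] --> F t.
  apply: differentiable_continuous; apply/derivable1_diffP.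
  exact: (@ex_derive _ _ _ _ _ _ _ (dF t)).
rewrite (@continuous_FTC2 _ _ F)//.
- rewrite /F cos_pihalf sin_pihalf cos0 sin0 /rotV/= !scale0r !scale1r.
  by rewrite add0r addr0.
- by rewrite divr_gt0// pi_gt0.
- by apply: continuous_subspaceT; exact: continuous_arc.
- split.
  + by move=> t _; exact: (@ex_derive _ _ _ _ _ _ _ (dF t)).
  + by apply: cvg_at_right_filter; exact: cF.
  + by apply: cvg_at_left_filter; exact: cF.
- by move=> t _; rewrite derive1E; exact: (@derive_val _ _ _ _ _ _ _ (dF t)).
Qed.

End calculus.

(** * Reduction to nonnegative convex functions *)

Section weights.
Local Open Scope ereal_scope.
Context d (T : measurableType d) (R : realType).
Variable mu : {measure set T -> \bar R}.

(** Symmetry of the laws is proved for nonnegative test functions only, so a vanishing mean is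
    obtained by comparing positive and negative parts; integrability makes their difference
    meaningful. *)
Lemma integral_symmetric0 (g : T -> R) : mu.-integrable setT (EFin \o g) ->
  \int[mu]_x (Num.max (g x) 0%R)%:E = \int[mu]_x (Num.max (- g x)%R 0%R)%:E ->
  \int[mu]_x (g x)%:E = 0.
Proof.
move=> ig e; rewrite integralE.
have -> : \int[mu]_x (fun x => (g x)%:E)^\+ x = \int[mu]_x (Num.max (g x) 0%R)%:E.
  by apply: eq_integral => x _; rewrite funeposE EFin_max.
have nE : \int[mu]_x (fun x => (g x)%:E)^\- x = \int[mu]_x (Num.max (- g x)%R 0%R)%:E.
  by apply: eq_integral => x _; rewrite funenegE EFin_max.
rewrite nE e -nE subee//; apply: integrable_fin_num => //.
exact: integrable_funeneg.
Qed.

Variables (w X : T -> R).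
Hypotheses (mw : measurable_fun setT w) (w0 : forall x, (0 <= w x)%R).
Hypothesis w1 : \int[mu]_x (w x)%:E = 1.
Hypotheses (mX : measurable_fun setT X).
Hypothesis iX : mu.-integrable setT (fun x => (X x * w x)%:E).

Lemma weight_integrable : mu.-integrable setT (EFin \o w).
Proof.
apply: ge0_integrable => [|x|]; [exact/measurable_EFinP|exact: w0|].
by rewrite w1 ltry.
Qed.

Lemma integral_add_affine (Psi : R -> R) (s b : R) :
  measurable_fun setT Psi -> (forall t, (0 <= Psi t)%R) ->
  \int[mu]_x (X x * w x)%:E = 0 ->
  \int[mu]_x ((Psi (X x) + (s * X x + b)) * w x)%:E =
  \int[mu]_x (Psi (X x) * w x)%:E + b%:E.
Proof.
move=> mPsi Psi0 X0.
have ia : mu.-integrable setT (fun x => s%:E * (X x * w x)%:E) by exact: integrableZl.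
have ib : mu.-integrable setT (fun x => b%:E * (w x)%:E).
  by apply: integrableZl => //; exact: weight_integrable.
transitivity (\int[mu]_x ((Psi (X x) * w x)%:E + (s * (X x * w x) + b * w x)%:E)).
  by apply: eq_integral => x _; rewrite -EFinD; congr EFin; ring.
rewrite (@ge0_integralD_integrable _ _ _ _
  (fun x => (Psi (X x) * w x)%:E) (fun x => (s * (X x * w x) + b * w x)%R)).
- congr (_ + _); under eq_integral do rewrite EFinD EFinM (EFinM b).
  rewrite integralD// integralZl// X0 mule0 add0e integralZl//; last exact: weight_integrable.
  by rewrite w1 mule1.
- apply/measurable_EFinP; apply: measurable_funM => //.
  exact: measurableT_comp.
- by move=> x; rewrite lee_fin mulr_ge0.
- exact: (integrableD measurableT ia ib).
Qed.

End weights.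

(* The library equips the product of two sigma-finite measures with no canonical
   sigma-finite structure, so Tonelli is applied one variable at a time. *)
Lemma fubini_tonelli_prod d1 d2 d3 (T1 : measurableType d1) (T2 : measurableType d2)
    (T3 : measurableType d3) (R : realType)
    (m1 : {sigma_finite_measure set T1 -> \bar R})
    (m2 : {sigma_finite_measure set T2 -> \bar R})
    (m3 : {sigma_finite_measure set T3 -> \bar R})
    (F : (T1 * T2) * T3 -> \bar R) :
  measurable_fun setT F -> (forall q, 0 <= F q)%E ->
  (\int[m1 \x m2]_p \int[m3]_t F (p, t) = \int[m3]_t \int[m1 \x m2]_p F (p, t))%E.
Proof.
move=> mF F0.
have mFx x : measurable_fun setT (fun q : T2 * T3 => F ((x, q.1), q.2)).
  apply: measurableT_comp mF _; apply: measurable_fun_pair => //.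
  exact: measurable_fun_pair.
have mFt : measurable_fun setT (fun q : (T1 * T3) * T2 => F ((q.1.1, q.2), q.1.2)).
  apply: measurableT_comp mF _; apply: measurable_fun_pair; last exact: measurableT_comp.
  by apply: measurable_fun_pair => //; exact: measurableT_comp.
have mK := measurable_fun_fubini_tonelli_F (m2 := m2) _ mFt (fun q => F0 _).
have K0 q : (0 <= \int[m2]_y F ((q.1, y), q.2))%E by exact: integral_ge0.
rewrite (fubini_tonelli1 (fun p => \int[m3]_t F (p, t)))%E.
- transitivity (\int[m1]_x \int[m3]_t \int[m2]_y F ((x, y), t))%E.
    by apply: eq_integral => x _; rewrite -(fubini_tonelli _ (mFx x)).
  rewrite (fubini_tonelli (fun q => \int[m2]_y F ((q.1, y), q.2))%E mK K0).
  apply: eq_integral => t _; rewrite (fubini_tonelli1 (fun p => F (p, t)))//.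
  exact: measurable_fun_pair1.
- exact: (measurable_fun_fubini_tonelli_F (m2 := m3) F).
- by move=> p; exact: integral_ge0.
Qed.

Lemma convexR_sub_affine (R : realType) (Phi : R -> R) : convexR Phi ->
  exists Psi s, [/\ convexR Psi, forall t, 0 <= Psi t &
    Phi = fun t => Psi t + (s * t + Phi 0)].
Proof.
move=> cPhi; have [s sP] := convexR_subgradient 0 cPhi.
exists (fun t => Phi t - (s * t + Phi 0)), s; split.
- by move=> t a b t01; have := cPhi t a b t01; lra.
- by move=> t; have := sP t; lra.
- by apply/funext => t; rewrite subrK.
Qed.

(** * Convexity of the averaged function *)

Section tilde.
Variable R : realType.

Lemma integrable_linear_gauss1 (k : R) :
  lebesgue_measure.-integrable setT (fun z : R => (k * z * gauss1 z)%:E).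
Proof.
have mg := @measurable_gauss1 R.
have ie : lebesgue_measure.-integrable setT (fun z : R => (expR `|z| * gauss1 z)%:E).
  apply: ge0_integrable; last exact: integral_expR_gauss1.
    by apply/measurable_EFinP; apply: measurable_funM => //; exact: measurable_expR_norm.
  by move=> z; rewrite lee_fin mulr_ge0 ?expR_ge0 ?gauss1_ge0.
apply: (le_integrable measurableT _ _ (integrableZl measurableT k ie)).
  by apply/measurable_EFinP; apply: measurable_funM => //; exact: measurable_funM.
move=> z _; rewrite -EFinM !abse_EFin lee_fin !normrM -mulrA.
rewrite ler_wpM2l// ler_wpM2r// [leRHS]ger0_norm ?expR_ge0//.
by have := expR_ge1Dx `|z|; lra.
Qed.

Lemma integral_linear_gauss1 (k : R) :
  (\int[lebesgue_measure]_z (k * z * gauss1 z)%:E = 0)%E.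
Proof.
apply: (integral_symmetric0 (integrable_linear_gauss1 k)).
have mH : measurable_fun setT (fun t : R => Num.max (k * t) 0).
  by apply: measurable_maxr => //; exact: measurable_funM.
have H0 (t : R) : 0 <= Num.max (k * t) 0 by rewrite le_max lexx orbT.
have maxM (t u : R) : 0 <= u -> Num.max (t * u) 0 = Num.max t 0 * u.
  by move=> u0; rewrite maxr_pMl// mul0r.
transitivity (\int[lebesgue_measure]_z (Num.max (k * z) 0 * gauss1 z)%:E)%E.
  by apply: eq_integral => z _; rewrite maxM ?gauss1_ge0.
rewrite -(gauss1_even mH H0); apply: eq_integral => z _.
by rewrite /= -maxM ?gauss1_ge0// mulrN mulNr.
Qed.

Lemma Phi_tildeE (Phi : R -> R) (a : R) : measurable_fun setT Phi ->
  (Phi_tilde Phi a = \int[lebesgue_measure]_z (Phi (pi / 2 * a * z) * gauss1 z)%:E)%E.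
Proof.
move=> mPhi; rewrite /Phi_tilde -integralZl_gt0.
- by apply: eq_integral => z _; rewrite -EFinM mulrCA.
- by rewrite invr_gt0 sqrtr_gt0 mulr_gt0// pi_gt0.
- apply/measurable_EFinP; apply: measurable_funM.
    by apply: measurableT_comp => //; exact: measurable_funM.
  apply: measurableT_comp => //; apply: measurableT_comp => //.
  by apply: measurable_funM => //; exact: measurable_funX.
Qed.

Lemma Phi_tilde_affine (Psi : R -> R) (s b a : R) :
  measurable_fun setT Psi -> (forall t, 0 <= Psi t) ->
  (Phi_tilde (fun t => Psi t + (s * t + b))%R a = Phi_tilde Psi a + b%:E)%E.
Proof.
move=> mPsi Psi0; rewrite !Phi_tildeE//; last first.
  by apply: measurable_funD => //; apply: measurable_funD => //; exact: measurable_funM.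
apply: (@integral_add_affine _ _ R lebesgue_measure (@gauss1 R) (fun z => pi / 2 * a * z)) => //.
- exact: measurable_gauss1.
- exact: gauss1_ge0.
- exact: integral_gauss1.
- exact: measurable_funM.
- exact: integrable_linear_gauss1.
- exact: integral_linear_gauss1.
Qed.

Lemma Phi_tilde_ge0 (Psi : R -> R) (a : R) : measurable_fun setT Psi ->
  (forall t, 0 <= Psi t) -> (0 <= Phi_tilde Psi a)%E.
Proof.
move=> mPsi Psi0; rewrite Phi_tildeE//; apply: integral_ge0 => z _.
by rewrite lee_fin mulr_ge0 ?gauss1_ge0.
Qed.

(** For each [z] the argument of Phi is linear in [a], so convexity passes to the integral. Working
    with the nonnegative [Psi] keeps this valid for infinite values and gives the bound [Phi 0] from
    below. *)
Lemma econvex_Phi_tilde (Phi : R -> R) : convexR Phi -> econvex (Phi_tilde Phi).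
Proof.
move=> /convexR_sub_affine[Psi [s [cPsi Psi0 ->]]].
have mPsi := convexR_measurable cPsi.
have T0 a := Phi_tilde_ge0 a mPsi Psi0.
split=> [a|t a b /andP[t0 t1]]; rewrite !Phi_tilde_affine//.
  by rewrite (lt_le_trans (ltNyr (Phi 0)))// leeDr.
have mP a' : measurable_fun setT (fun z => (Psi (pi / 2 * a' * z) * gauss1 z)%:E).
  apply/measurable_EFinP; apply: measurable_funM; last exact: measurable_gauss1.
  by apply: measurableT_comp => //; exact: measurable_funM.
have P0 a' z : (0 <= (Psi (pi / 2 * a' * z) * gauss1 z)%:E)%E.
  by rewrite lee_fin mulr_ge0 ?gauss1_ge0.
have u0 : 0 <= 1 - t by lra.
have TP : (Phi_tilde Psi (t * a + (1 - t) * b)%R <=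
           t%:E * Phi_tilde Psi a + (1 - t)%:E * Phi_tilde Psi b)%E.
  have TZ k a' : 0 <= k -> (k%:E * Phi_tilde Psi a' =
      \int[lebesgue_measure]_z (k%:E * (Psi (pi / 2 * a' * z)%R * gauss1 z)%:E))%E.
    move=> k0; rewrite Phi_tildeE// ge0_integralZl_EFin//; exact: mP.
  rewrite Phi_tildeE// !TZ// -ge0_integralD//; last 4 first.
  - by move=> z _; rewrite mule_ge0.
  - by apply: measurable_funeM; exact: mP.
  - by move=> z _; rewrite mule_ge0.
  - by apply: measurable_funeM; exact: mP.
  apply: ge0_le_integral => //; first exact: mP.
    by apply: emeasurable_funD; apply: measurable_funeM; exact: mP.
  move=> z _; have := gauss1_ge0 z; move: (gauss1 z) => g g0.
  rewrite -!EFinM -EFinD lee_fin !mulrA -mulrDl; apply: ler_wpM2r => //.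
  have -> : pi / 2 * (t * a + (1 - t) * b) * z =
      t * (pi / 2 * a * z) + (1 - t) * (pi / 2 * b * z) by ring.
  by apply: cPsi; rewrite t0.
rewrite !muleDr ?fin_num_adde_defl//.
rewrite addeACA -!EFinM -EFinD (_ : t * Phi 0 + (1 - t) * Phi 0 = Phi 0)%R; last by ring.
by rewrite leeD2r.
Qed.

End tilde.

(** * The inequality *)

Section maurey_pisier.
Variables (R : realType) (n : nat) (f : 'rV[R]_n -> R).
Hypothesis f_C1poly : C_poly 1 f.

Local Notation lam := (lebesgue_rV R n).
Local Notation V := 'rV[R]_n.

Let df i (x : V) : derivable f x (delta_mx ord0 i).
Proof. by case: f_C1poly => _ _ /(_ i)[]. Qed.

Let cf i : continuous (partial i f).
Proof. by case: f_C1poly => _ _ /(_ i)[_ []]. Qed.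

Let mf : measurable_fun setT f.
Proof. by case: f_C1poly => cf0 _ _; exact: continuous_measurable_rV. Qed.

Let mgrad : measurable_fun setT (grad f).
Proof.
apply: measurable_fun_rV => i; under eq_fun do rewrite mxE.
exact: continuous_measurable_rV.
Qed.

Let mdot d (T : measurableType d) (u v : T -> V) :
  measurable_fun setT u -> measurable_fun setT v ->
  measurable_fun setT (fun t => dot (u t) (v t)).
Proof.
move=> mu mv; apply: measurable_sum => i; apply: measurable_funM.
  exact: (measurableT_comp (@measurable_coord_rV R n i) mu).
exact: (measurableT_comp (@measurable_coord_rV R n i) mv).
Qed.

Let menorm : measurable_fun setT (fun x => enorm (grad f x)).
Proof.
have ms : measurable_fun setT (@Num.sqrt R).
  by apply: continuous_measurable_fun; exact: sqrt_continuous.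
exact: (measurableT_comp ms (mdot mgrad mgrad)).
Qed.

Let mgauss := @measurable_gauss R n.

Definition pgauss (p : V * V) : R := gauss p.1 * gauss p.2.

Let mpgauss : measurable_fun setT pgauss.
Proof.
apply: measurable_funM; first exact: (measurableT_comp mgauss measurable_fst).
exact: (measurableT_comp mgauss measurable_snd).
Qed.

Let pgauss_ge0 p : 0 <= pgauss p.
Proof. by rewrite mulr_ge0 ?gauss_ge0. Qed.

Let L (p : V * V) : R := dot (grad f p.1) p.2.

Let mL : measurable_fun setT L.
Proof. by apply: mdot => //; exact: measurableT_comp. Qed.

Lemma integral_prod_gauss (a b : V -> R) :
  measurable_fun setT a -> measurable_fun setT b ->
  (forall x, 0 <= a x) -> (forall x, 0 <= b x) ->
  (\int[lam \x lam]_p (a p.1 * b p.2)%:E =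
   \int[lam]_x (a x)%:E * \int[lam]_y (b y)%:E)%E.
Proof.
move=> ma mb a0 b0; rewrite (fubini_tonelli1 (fun p => (a p.1 * b p.2)%:E)); last 2 first.
- apply/measurable_EFinP; apply: measurable_funM; first exact: (measurableT_comp ma measurable_fst).
  exact: (measurableT_comp mb measurable_snd).
- by move=> p; rewrite lee_fin mulr_ge0.
have b0' : (0 <= \int[lam]_y (b y)%:E)%E by apply: integral_ge0 => y _; rewrite lee_fin.
rewrite -ge0_integralZr//; last 2 first.
- exact/measurable_EFinP.
- by move=> x _; rewrite lee_fin.
apply: eq_integral => x _; rewrite /fubini_F/= -ge0_integralZl//.
- exact/measurable_EFinP.
- by move=> y _; rewrite lee_fin.
- by rewrite lee_fin.
Qed.

Let integral_pgauss : (\int[lam \x lam]_p (pgauss p)%:E = 1)%E.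
Proof.
rewrite (integral_prod_gauss mgauss mgauss (@gauss_ge0 _ _) (@gauss_ge0 _ _)).
by rewrite !integral_gauss mule1.
Qed.

(** [H] is arbitrary because this serves twice: for the symmetry of [L], and with H t = Psi (pi / 2
    * t) for the passage to [Phi_tilde]. *)
Lemma decoupled_marginal (H : R -> R) : measurable_fun setT H -> (forall t, 0 <= H t) ->
  (\int[lam \x lam]_p (H (L p) * pgauss p)%:E =
   \int[lam]_x ((gauss x)%:E * \int[lebesgue_measure]_z (H (enorm (grad f x) * z) * gauss1 z)%:E))%E.
Proof.
move=> mH H0; rewrite (fubini_tonelli1 (fun p => (H (L p) * pgauss p)%:E)); last 2 first.
- by apply/measurable_EFinP; apply: measurable_funM => //; exact: measurableT_comp.
- by move=> p; rewrite lee_fin mulr_ge0.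
apply: eq_integral => x _; rewrite -gauss_marginal// -ge0_integralZl_EFin ?gauss_ge0//.
- by apply: eq_integral => y _; rewrite /pgauss/= -EFinM; congr EFin; rewrite mulrCA.
- by move=> y _; rewrite lee_fin mulr_ge0 ?gauss_ge0.
- apply/measurable_EFinP; apply: measurable_funM => //.
  by apply: measurableT_comp => //; exact: measurable_dotr.
Qed.

Let norm_le_expl1 (y : V) i : `|y ord0 i| <= expl1 y.
Proof.
rewrite /expl1 (bigD1 i)//=.
have h1 : `|y ord0 i| <= expR `|y ord0 i| by have := expR_ge1Dx `|y ord0 i|; lra.
apply: (le_trans h1); rewrite ler_peMr ?expR_ge0//.
apply: (big_ind (fun u : R => 1 <= u)) => // [u v u1 v1|j _]; first exact: mulr_ege1.
by rewrite -expR0 ler_expR.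
Qed.

(** The partials are bounded by a multiple of [expl1 p.1] and each coordinate of [p.2] by
    [expl1 p.2], so |L| is dominated by a product of functions of separate variables. *)
Let integrable_L : (lam \x lam)%E.-integrable setT (fun p => (L p * pgauss p)%:E).
Proof.
have /choice[C CP] : forall i, exists C : R, forall x, `|partial i f x| <= C * expl1 x.
  by move=> i; apply: poly_bounded_expl1; case: f_C1poly => _ _ /(_ i)[_ []].
pose e (p : V * V) : R := (expl1 p.1 * gauss p.1) * (expl1 p.2 * gauss p.2).
have me : measurable_fun setT (fun x : V => expl1 x * gauss x).
  by apply: measurable_funM => //; exact: measurable_expl1.
have e0 (x : V) : 0 <= expl1 x * gauss x by rewrite mulr_ge0 ?expl1_ge0 ?gauss_ge0.
have ie : (lam \x lam)%E.-integrable setT (EFin \o e).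
  apply: ge0_integrable.
  - apply/measurable_EFinP; apply: measurable_funM.
      exact: (measurableT_comp me measurable_fst).
    exact: (measurableT_comp me measurable_snd).
  - by move=> p; rewrite lee_fin mulr_ge0.
  - rewrite (integral_prod_gauss me me e0 e0).
    have le := @integral_expl1_gauss R n.
    have ge : (0 <= \int[lam]_x (expl1 x * gauss x)%:E)%E.
      by apply: integral_ge0 => x _; rewrite lee_fin.
    by rewrite lte_mul_pinfty// ge0_fin_numE.
apply: (le_integrable measurableT _ _ (integrableZl measurableT (\sum_i C i) ie)).
  by apply/measurable_EFinP; exact: measurable_funM.
move=> p _; rewrite /= !lee_fin.
have -> : (\sum_i C i) * e p = (\sum_i C i) * (expl1 p.1 * expl1 p.2) * pgauss p.
  rewrite /e /pgauss; move: (gauss p.1) (gauss p.2) (expl1 p.1) (expl1 p.2) => g1 g2 e1 e2.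
  by ring.
rewrite normrM [leRHS]normrM; apply: ler_wpM2r => //.
apply: le_trans (ler_norm _); rewrite mulr_suml.
apply: le_trans (ler_norm_sum _ _ _) _; apply: ler_sum => i _.
rewrite normrM mxE mulrA; apply: ler_pM => //; exact: norm_le_expl1.
Qed.

Let even_L (H : R -> R) : measurable_fun setT H -> (forall t, 0 <= H t) ->
  (\int[lam \x lam]_p (H (- L p) * pgauss p)%:E =
   \int[lam \x lam]_p (H (L p) * pgauss p)%:E)%E.
Proof.
move=> mH H0; have mHN : measurable_fun setT (fun t : R => H (- t)) by exact: measurableT_comp.
apply: etrans (decoupled_marginal mHN (fun t => H0 _)) _.
apply: etrans _ (esym (decoupled_marginal mH H0)).
apply: eq_integral => x _; congr (_ * _)%E.
rewrite -(gauss1_even (H := fun z : R => H (enorm (grad f x) * z)))//.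
  by apply: eq_integral => z _; rewrite mulrN.
by apply: measurableT_comp => //; exact: measurable_funM.
Qed.

Let integral_L : (\int[lam \x lam]_p (L p * pgauss p)%:E = 0)%E.
Proof.
apply: (integral_symmetric0 integrable_L).
have mH : measurable_fun setT (fun t : R => Num.max t 0) by exact: measurable_maxr.
have H0 (t : R) : 0 <= Num.max t 0 by rewrite le_max lexx orbT.
have maxM p : Num.max (L p * pgauss p) 0 = Num.max (L p) 0 * pgauss p.
  by rewrite maxr_pMl// mul0r.
have maxNM p : Num.max (- (L p * pgauss p)) 0 = Num.max (- L p) 0 * pgauss p.
  by rewrite maxr_pMl// mul0r mulNr.
transitivity (\int[lam \x lam]_p (Num.max (L p) 0 * pgauss p)%:E)%E.
  by apply: eq_integral => p _; rewrite maxM.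
rewrite -(even_L mH H0); apply: eq_integral => p _.
by rewrite maxNM.
Qed.

Let f_bound : exists C : R, forall x, `|f x| <= C * expl1 x.
Proof. by apply: poly_bounded_expl1; case: f_C1poly. Qed.

Let integrable_f : lam.-integrable setT (fun x => (f x * gauss x)%:E).
Proof. by have [C CP] := f_bound; exact: expl1_bound_gauss_integrable CP. Qed.

Let integrable_gauss : lam.-integrable setT (fun x => (gauss x)%:E).
Proof. exact: weight_integrable mgauss (@gauss_ge0 _ _) (@integral_gauss _ _). Qed.

Let mean := (\int[lam]_y (f y * gauss y))%R.

Let meanE : (\int[lam]_y (f y * gauss y)%:E = mean%:E)%E.
Proof. by rewrite /mean /Rintegral fineK//; exact: integrable_fin_num. Qed.

(** Applied to [f x - f y] as a function of [y], and to [f x - mean]. *)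
Let integrable_affine_f (a b : R) : lam.-integrable setT (fun x => ((a * f x + b) * gauss x)%:E).
Proof.
have := integrableD measurableT (integrableZl measurableT a integrable_f)
  (integrableZl measurableT b integrable_gauss).
apply: eq_integrable => // x _; rewrite -!EFinM -EFinD; congr EFin.
by rewrite mulrDl -mulrA.
Qed.

Let integral_affine_f (a b : R) :
  (\int[lam]_x ((a * f x + b) * gauss x)%:E = (a * mean + b)%:E)%E.
Proof.
transitivity (\int[lam]_x (a%:E * (f x * gauss x)%:E + b%:E * (gauss x)%:E))%E.
  by apply: eq_integral => x _; rewrite -!EFinM -EFinD mulrDl -mulrA.
rewrite integralD//; try exact: integrableZl.
by rewrite !integralZl// meanE integral_gauss mule1.
Qed.

Let mdiff : measurable_fun setT (fun p : V * V => f p.2 - f p.1).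
Proof.
apply: measurable_funB; first exact: (measurableT_comp mf measurable_snd).
exact: (measurableT_comp mf measurable_fst).
Qed.

(** * The inequality for nonnegative convex functions *)

Variable Psi : R -> R.
Hypotheses (cPsi : convexR Psi) (Psi0 : forall t, 0 <= Psi t).

Let mPsi := convexR_measurable cPsi.

Let symmetrization :
  (\int[lam]_x (Psi (f x - mean) * gauss x)%:E <=
   \int[lam \x lam]_p (Psi (f p.2 - f p.1) * pgauss p)%:E)%E.
Proof.
have mG : measurable_fun setT (fun p : V * V => (Psi (f p.2 - f p.1) * pgauss p)%:E).
  by apply/measurable_EFinP; apply: measurable_funM => //; exact: measurableT_comp.
have G0 (p : V * V) : (0 <= (Psi (f p.2 - f p.1) * pgauss p)%:E)%E.
  by rewrite lee_fin mulr_ge0.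
(* The first component of [p] is Y and the second X, so the inner integral is over the first. *)
rewrite (fubini_tonelli2 _ mG G0); apply: ge0_le_integral => //.
- by move=> x _; rewrite lee_fin mulr_ge0 ?gauss_ge0.
- apply/measurable_EFinP; apply: measurable_funM => //.
  by apply: measurableT_comp => //; exact: measurable_funB.
- exact: measurable_fun_fubini_tonelli_G.
move=> x _; rewrite /fubini_G.
have mX : measurable_fun setT (fun y => f x - f y) by exact: measurable_funB.
have mP : measurable_fun setT (fun y => (Psi (f x - f y) * gauss y)%:E).
  by apply/measurable_EFinP; apply: measurable_funM => //; exact: measurableT_comp.
have -> : (\int[lam]_y (Psi (f (y, x).2 - f (y, x).1) * pgauss (y, x))%:E =
    (gauss x)%:E * \int[lam]_y (Psi (f x - f y)%R * gauss y)%:E)%E.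
  have P0 y : setT y -> (0 <= (Psi (f x - f y) * gauss y)%:E)%E.
    by move=> _; rewrite lee_fin mulr_ge0 ?gauss_ge0.
  rewrite -(ge0_integralZl_EFin lam measurableT P0 mP (gauss_ge0 x)).
  apply: eq_integral => y _; rewrite -EFinM /pgauss/=; congr EFin.
  by move: (gauss x) (gauss y) => gx gy; ring.
rewrite mulrC EFinM; apply: lee_wpmul2l; first by rewrite lee_fin gauss_ge0.
have XE y : f x - f y = (- 1) * f y + f x by ring.
apply: (jensen_weight cPsi Psi0 mX mgauss (@gauss_ge0 _ _) (@integral_gauss _ _)).
  apply: eq_integrable (integrable_affine_f (-1) (f x)) => // y _.
  by rewrite XE.
under eq_integral do rewrite XE; rewrite integral_affine_f; congr EFin; ring.
Qed.

(** The uniform probability density on the parameter interval; as a weight on the whole line it fits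
    [jensen_weight]. *)
Let arc_weight (t : R) : R := 2 / pi * \1_(`[0%R, (pi / 2)%R]%classic) t.

Let arc_weight_ge0 t : 0 <= arc_weight t.
Proof. by rewrite mulr_ge0// divr_ge0// pi_ge0. Qed.

Let marc_weight : measurable_fun setT arc_weight.
Proof. by apply: measurable_funM => //; exact: measurable_indic. Qed.

Let integral_arc_weight : (\int[lebesgue_measure]_t (arc_weight t)%:E = 1)%E.
Proof.
under eq_integral do rewrite EFinM.
rewrite ge0_integralZl_EFin ?divr_ge0 ?pi_ge0//; last first.
  by apply/measurable_EFinP; exact: measurable_indic.
rewrite integral_indic//= setIT lebesgue_measure_itv/= lte_fin divr_gt0 ?pi_gt0//.
by rewrite -EFinD -EFinM subr0 mulrA divfK ?divff// gt_eqF ?pi_gt0.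
Qed.

Let arc (t : R) (p : V * V) : R := L (rotV (cos t) (sin t) p).

Let arc_jensen (p : V * V) :
  ((Psi (f p.2 - f p.1))%:E <=
   \int[lebesgue_measure]_t (Psi (pi / 2 * arc t p) * arc_weight t)%:E)%E.
Proof.
have carc : continuous (fun t : R => arc t p) by exact: continuous_arc.
have marc : measurable_fun setT (fun t : R => arc t p) by exact: continuous_measurable_fun.
(* The factors pi/2 and 2/pi cancel, leaving the plain integral over [0, pi/2], which is the
   increment of [f]. *)
have arcE t : (pi / 2 * arc t p * arc_weight t)%:E =
    ((fun t => (arc t p)%:E) \_ `[0%R, (pi / 2)%R]%classic) t.
  rewrite /arc_weight indicE patchE; case: ifPn => _; last by rewrite !mulr0.
  have := lt0r_neq0 (pi_gt0 R); rewrite mulr1; move: (arc t p) (pi : R) => u q q0.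
  by congr EFin; field.
apply: (@jensen_weight _ _ R lebesgue_measure Psi (fun t => pi / 2 * arc t p) arc_weight) => //.
- exact: measurable_funM.
- rewrite (funext arcE).
  apply/integrable_restrict => //; rewrite setTI.
  apply: continuous_compact_integrable; first exact: segment_compact.
  exact: continuous_subspaceT.
- under eq_integral do rewrite arcE.
  by rewrite -integral_mkcond; exact: integral_arc.
Qed.

Let decoupling :
  (\int[lam \x lam]_p (Psi (f p.2 - f p.1) * pgauss p)%:E <=
   \int[lam \x lam]_p (Psi (pi / 2 * L p) * pgauss p)%:E)%E.
Proof.
pose G (p : V * V) : R := Psi (pi / 2 * L p) * pgauss p.
have G0 p : (0 <= (G p)%:E)%E by rewrite lee_fin mulr_ge0.
have mG : measurable_fun setT (EFin \o G).
  apply/measurable_EFinP; apply: measurable_funM => //; apply: measurableT_comp => //.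
  exact: measurable_funM.
have mrot : measurable_fun setT (fun q : (V * V) * R => rotV (cos q.2) (sin q.2) q.1).
  have mcos : measurable_fun setT (fun q : (V * V) * R => cos q.2).
    by apply: measurableT_comp => //; apply: continuous_measurable_fun; exact: continuous_cos.
  have msin : measurable_fun setT (fun q : (V * V) * R => sin q.2).
    by apply: measurableT_comp => //; apply: continuous_measurable_fun; exact: continuous_sin.
  have m1 : measurable_fun setT (fun q : (V * V) * R => q.1.1) by exact: measurableT_comp.
  have m2 : measurable_fun setT (fun q : (V * V) * R => q.1.2) by exact: measurableT_comp.
  apply: measurable_fun_pair; apply: measurable_rV_sum => //; exact: measurableT_comp.
(* The product density is rotation invariant, so rotating the whole integrand changes only the
   argument of [Psi]. *)
have GE t p : G (rotV (cos t) (sin t) p) = Psi (pi / 2 * arc t p) * pgauss p.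
  by rewrite /G /pgauss gauss_rotV// cos2Dsin2.
pose F (q : (V * V) * R) := (G (rotV (cos q.2) (sin q.2) q.1) * arc_weight q.2)%:E.
have F0 q : (0 <= F q)%E by rewrite lee_fin mulr_ge0// mulr_ge0.
have mF : measurable_fun setT F.
  apply/measurable_EFinP; apply: measurable_funM; last exact: measurableT_comp.
  by apply: (measurableT_comp (f := G)) => //; apply/measurable_EFinP.
apply: (@le_trans _ _ (\int[lam \x lam]_p \int[lebesgue_measure]_t F (p, t))%E).
  apply: ge0_le_integral => //.
  - by move=> p _; rewrite lee_fin mulr_ge0.
  - by apply/measurable_EFinP; apply: measurable_funM => //; exact: measurableT_comp.
  - exact: (measurable_fun_fubini_tonelli_F (m2 := lebesgue_measure) F).
  move=> p _.
  have -> : (\int[lebesgue_measure]_t F (p, t) = (pgauss p)%:E *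
      \int[lebesgue_measure]_t (Psi (pi / 2 * arc t p)%R * arc_weight t)%:E)%E.
    rewrite -ge0_integralZl_EFin//.
    - by apply: eq_integral => t _; rewrite /F GE/= -EFinM; congr EFin; ring.
    - by move=> t _; rewrite lee_fin mulr_ge0.
    - apply/measurable_EFinP; apply: measurable_funM => //; apply: measurableT_comp => //.
      by apply: measurable_funM => //; apply: continuous_measurable_fun; exact: continuous_arc.
  by rewrite mulrC EFinM; apply: lee_wpmul2l; rewrite ?lee_fin.
rewrite (fubini_tonelli_prod _ _ lebesgue_measure mF F0).
have -> : (\int[lebesgue_measure]_t \int[lam \x lam]_p F (p, t) =
    \int[lebesgue_measure]_t ((arc_weight t)%:E * \int[lam \x lam]_p (G p)%:E))%E.
  apply: eq_integral => t _.
  (* For each [t] the rotation is undone, so the integral over [p] no longer depends on [t] and the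
     weight integrates to 1. *)
  rewrite -(ge0_integral_rotV (cos2Dsin2 t) mG G0) -ge0_integralZl_EFin//.
  - by apply: eq_integral => p _; rewrite /F/= -EFinM mulrC.
  - by move=> p _; exact: G0.
  - exact: (measurableT_comp mG (measurable_rotV _ _)).
rewrite ge0_integralZr//.
- by rewrite integral_arc_weight mul1e.
- exact/measurable_EFinP.
- by move=> t _; rewrite lee_fin.
- exact: integral_ge0.
Qed.

Lemma maurey_pisier_ge0 :
  (\int[lam]_x (Psi (f x - mean) * gauss x)%:E <=
   \int[lam \x lam]_p (Psi (pi / 2 * L p) * pgauss p)%:E)%E.
Proof. exact: le_trans symmetrization decoupling. Qed.

(** * Restoring the affine part *)

Variables (s b : R).
Let Phi t := Psi t + (s * t + b).

Let mPhi : measurable_fun setT Phi.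
Proof. by apply: measurable_funD => //; apply: measurable_funD => //; exact: measurable_funM. Qed.

Lemma deviation_affine :
  (\int[lam]_x (Phi (f x - mean) * gauss x)%:E =
   \int[lam]_x (Psi (f x - mean) * gauss x)%:E + b%:E)%E.
Proof.
have XE x : f x - mean = 1 * f x + - mean by rewrite mul1r.
apply: (@integral_add_affine _ _ R lam (@gauss R n) (fun x => f x - mean)) => //.
- exact: gauss_ge0.
- exact: integral_gauss.
- exact: measurable_funB.
- under eq_fun do rewrite XE; exact: integrable_affine_f.
- by under eq_integral do rewrite XE; rewrite integral_affine_f mul1r subrr.
Qed.

Lemma decoupled_affine :
  (\int[lam \x lam]_p (Phi (pi / 2 * L p) * gauss p.1 * gauss p.2)%:E =
   \int[lam \x lam]_p (Psi (pi / 2 * L p) * pgauss p)%:E + b%:E)%E.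
Proof.
have XE p : (pi / 2 * L p * pgauss p)%:E = ((pi / 2)%:E * (L p * pgauss p)%:E)%E.
  by move: (pgauss p) => g; rewrite -EFinM mulrA.
transitivity (\int[lam \x lam]_p (Phi (pi / 2 * L p) * pgauss p)%:E)%E.
  by apply: eq_integral => p _; rewrite /pgauss [in RHS]mulrA.
apply: (@integral_add_affine _ _ R (lam \x lam)%E pgauss (fun p => pi / 2 * L p)) => //.
- exact: measurable_funM.
- by under eq_fun do rewrite XE; exact: integrableZl.
- by under eq_integral do rewrite XE; rewrite integralZl// integral_L mule0.
Qed.

Let measurable_tilde : measurable_fun setT (fun x => Phi_tilde Psi (enorm (grad f x))).
Proof.
rewrite (_ : (fun _ => _) = (fun x => \int[lebesgue_measure]_z
    (Psi (pi / 2 * enorm (grad f x) * z) * gauss1 z)%:E)%E); last first.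
  by apply/funext => x; exact: Phi_tildeE.
have mF : measurable_fun setT
    (fun p : V * R => (Psi (pi / 2 * enorm (grad f p.1) * p.2) * gauss1 p.2)%:E).
  apply/measurable_EFinP; apply: measurable_funM.
    apply: measurableT_comp => //; apply: measurable_funM => //; apply: measurable_funM => //.
    exact: (measurableT_comp menorm measurable_fst).
  exact: (measurableT_comp (@measurable_gauss1 R) measurable_snd).
apply: (measurable_fun_fubini_tonelli_F (m2 := lebesgue_measure) _ mF) => p.
by rewrite lee_fin mulr_ge0 ?gauss1_ge0.
Qed.

Let measurable_tilde_gauss (g : V -> \bar R) : measurable_fun setT g ->
  measurable_fun setT (fun x => g x * (gauss x)%:E)%E.
Proof. by move=> mg; apply: emeasurable_funM => //; exact/measurable_EFinP. Qed.

Lemma integral_tilde :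
  (\int[lam]_x (Phi_tilde Phi (enorm (grad f x)) * (gauss x)%:E) =
   \int[lam \x lam]_p (Psi (pi / 2 * L p) * pgauss p)%:E + b%:E)%E.
Proof.
have mH : measurable_fun setT (fun t : R => Psi (pi / 2 * t)).
  by apply: measurableT_comp => //; exact: measurable_funM.
have -> := decoupled_marginal mH (fun t => Psi0 _).
transitivity (\int[lam]_x (Phi_tilde Psi (enorm (grad f x)) * (gauss x)%:E + (b * gauss x)%:E))%E.
  apply: eq_integral => x _; rewrite Phi_tilde_affine//.
  by rewrite muleDl ?fin_num_adde_defl// EFinM.
rewrite (@ge0_integralD_integrable _ _ _ _
  (fun x => Phi_tilde Psi (enorm (grad f x)) * (gauss x)%:E)%E (fun x => b * gauss x)).
- congr (_ + _)%E.
    apply: eq_integral => x _; rewrite Phi_tildeE// muleC; congr (_ * _)%E.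
    by apply: eq_integral => z _; rewrite mulrA.
  under eq_integral do rewrite EFinM.
  by rewrite integralZl// integral_gauss mule1.
- exact: measurable_tilde_gauss.
- by move=> x; rewrite mule_ge0 ?lee_fin ?gauss_ge0// Phi_tilde_ge0.
- exact: (integrableZl measurableT b integrable_gauss).
Qed.

Lemma integral_one_dim :
  ((Num.sqrt (2 * pi))^-1%:E * \int[lam]_x \int[lebesgue_measure]_z
      (Phi (pi / 2 * enorm (grad f x) * z) * expR (- (z ^+ 2 / 2)) * gauss x)%:E =
   \int[lam]_x (Phi_tilde Phi (enorm (grad f x)) * (gauss x)%:E))%E.
Proof.
have q0 : 0 < Num.sqrt (2 * pi) :> R by rewrite sqrtr_gt0 mulr_gt0// pi_gt0.
have mtilde : measurable_fun setT (fun x => Phi_tilde Phi (enorm (grad f x)) * (gauss x)%:E)%E.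
  apply: measurable_tilde_gauss; under eq_fun do rewrite Phi_tilde_affine//.
  exact: emeasurable_funD.
(* The factor sqrt(2 pi) gauss(x) is strictly positive, so it leaves the inner integral by
   [integralZl_gt0] although Phi may change sign. *)
have -> : (\int[lam]_x \int[lebesgue_measure]_z
      (Phi (pi / 2 * enorm (grad f x) * z) * expR (- (z ^+ 2 / 2)) * gauss x)%:E =
    \int[lam]_x ((Num.sqrt (2 * pi))%:E * (Phi_tilde Phi (enorm (grad f x)) * (gauss x)%:E)))%E.
  apply: eq_integral => x _; rewrite (muleC (Phi_tilde _ _)) muleA -EFinM Phi_tildeE//.
  rewrite -integralZl_gt0.
  - apply: eq_integral => z _; rewrite -EFinM /gauss1; congr EFin.
    move: (gauss x) (expR _) (Phi _) => g e u; field; exact: lt0r_neq0.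
  - by rewrite mulr_gt0// gauss_gt0.
  - apply/measurable_EFinP; apply: measurable_funM; last exact: measurable_gauss1.
    by apply: measurableT_comp => //; exact: measurable_funM.
rewrite integralZl_gt0// muleA -EFinM mulVf ?mul1e//; exact: lt0r_neq0.
Qed.

End maurey_pisier.

Theorem proposition2 (R : realType) (n : nat) (n_ge1 : (1 <= n)%N)
    (Phi : R -> R) (f : 'rV[R]_n -> R)
    (Phi_convex : convex_function [set: R] Phi) (f_C1poly : C_poly 1 f) :
  let mean := \int[lebesgue_rV R n]_y (f y * gauss y) in
  let deviation := (\int[lebesgue_rV R n]_x (Phi (f x - mean) * gauss x)%:E)%E in
  let decoupled := (\int[lebesgue_rV R n \x lebesgue_rV R n]_p
    (Phi (pi / 2 * dot (grad f p.1) p.2) * gauss p.1 * gauss p.2)%:E)%E in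
  let one_dim := ((Num.sqrt (2 * pi))^-1%:E *
    \int[lebesgue_rV R n]_x \int[lebesgue_measure]_z
      (Phi (pi / 2 * enorm (grad f x) * z) * expR (- (z ^+ 2 / 2)) *
       gauss x)%:E)%E in
  let tilde :=
    (\int[lebesgue_rV R n]_x (Phi_tilde Phi (enorm (grad f x)) * (gauss x)%:E))%E in
  [/\ econvex (Phi_tilde Phi),
      (-oo < deviation)%E,
      (deviation <= decoupled)%E,
      decoupled = one_dim &
      one_dim = tilde].
Proof.
have cPhi := convex_functionR Phi_convex.
have econv := econvex_Phi_tilde cPhi.
have [Psi [s [cPsi Psi0 PhiE]]] := convexR_sub_affine cPhi.
(* [Phi 0] is generalized first, since [PhiE] would otherwise define Phi in terms of itself and
   could not be substituted. *)
move: (Phi 0) PhiE => b PhiE; subst Phi => mean deviation decoupled one_dim tilde.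
have deviationE : deviation = _ := deviation_affine f_C1poly cPsi Psi0 s b.
have decoupledE : decoupled = _ := decoupled_affine f_C1poly cPsi Psi0 s b.
have one_dimE : one_dim = tilde := integral_one_dim f_C1poly cPsi Psi0 s b.
have tildeE : tilde = _ := integral_tilde f_C1poly cPsi Psi0 s b.
split; [exact: econv| | | |exact: one_dimE].
(* The deviation is the constant [b] plus the integral of a nonnegative function. *)
- rewrite deviationE (lt_le_trans (ltNyr b))// leeDr//.
  by apply: integral_ge0 => x _; rewrite lee_fin mulr_ge0 ?gauss_ge0.
- rewrite deviationE decoupledE leeD2r//; exact: maurey_pisier_ge0.
- by rewrite one_dimE decoupledE tildeE.
Qed.
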